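(* Assume that $H$ is $1$-strongly convex with respect to the norm $\|\cdot\|$ and that there exist $D,L,\sigma>0$ such that for all $x,y\in\mathcal{X}$ $$D^F(x,y)\le\frac{L}{2}\|x-y\|^2,\qquad \mathbb{E}_\xi\big[\|\nabla f_\xi(x)-\nabla F(x)\|_*^2\big]\le\sigma^2,\qquad \|x-y\|^2\le D^2,\qquad H(x_F)-H(x)\le D^2,$$ where $x_F$ is the minimizer of $F$ on $\mathcal{X}$. Run the accelerated composite mirror descent algorithm for $T\ge1$ iterations with the oblivious polynomial step-sizes of degree $n>0$ and parameter $\mu$ (both described in the context). Then for any $\mu>0$ with $2\sqrt{L/\mu}\le T$, $$\mathbb{E}[F(x_{T+1}^{ag})]-F_\star=O\left(\frac{\mu D^H(x_F,x_1)}{nT^{n+1}}+\mu D^2+\frac{n\sigma^2}{\mu T}+\frac{LD^2}{T}\Big(\frac{Ln}{\mu T^2}\Big)^{n/2}\right),$$ where the implied constant depends only on $n$ and on the proportionality constants in the step-sizes.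
   Context: Problem: minimize $F(x)=\mathbb{E}_\xi[f_\xi(x)]$ over a closed convex set $\mathcal{X}\subseteq\mathbb{R}^d$, where $\xi$ is a random variable and the $f_\xi$ are convex functions, $F$ differentiable. A stochastic gradient oracle $\nabla f_\xi(x)$ is available with $\mathbb{E}_\xi[\nabla f_\xi(x)]=\nabla F(x)$ for all $x\in\mathcal{X}$. $F_\star=\min_{\mathcal{X}}F=F(x_F)$. The regularizer $H$ is a continuously differentiable strictly convex function. For a continuously differentiable function $f$ the Bregman divergence is $D^f(x,y)=f(x)-f(y)-\langle\nabla f(y),x-y\rangle$. $\|\cdot\|_*$ is the dual norm of $\|\cdot\|$; $H$ being $1$-strongly convex means $D^H(x,y)\ge\frac12\|x-y\|^2$. Accelerated composite mirror descent algorithm: put $A_t=\sum_{\tau=1}^t\alpha_\tau$, $A_0=0$. From a starting point $x_1\in\mathcal{X}$ (with $x_1^{ag}\in\mathcal{X}$ arbitrary, its weight being $A_0=0$), with independent samples $\xi_1,\xi_2,\dots$ of $\xi$, for $t=1,\dots,T$ compute $$x_t^{md}=\tfrac{A_{t-1}}{A_t}x_t^{ag}+\tfrac{\alpha_t}{A_t}x_t,$$ $$x_{t+1}=\arg\min_{x\in\mathcal{X}}\{\alpha_t\langle\nabla f_{\xi_t}(x_t^{md}),x\rangle+\beta_tH(x)+\gamma_tD^H(x,x_t)\},$$ $$x_{t+1}^{ag}=\tfrac{A_{t-1}}{A_t}x_t^{ag}+\tfrac{\alpha_t}{A_t}x_{t+1}.$$ The output is $x_{T+1}^{ag}$. Oblivious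 polynomial step-sizes of degree $n$ and parameter $\mu>0$: $\alpha_t\propto t^n$, $\beta_t\propto\mu t^n$, $\gamma_t\propto\mu t^{n+1}/(n+1)$, i.e. $\alpha_t=a\,t^n$, $\beta_t=b\,\mu t^n$, $\gamma_t=c\,\mu t^{n+1}/(n+1)$ with positive proportionality constants $a,b,c$ depending only on $n$, chosen so that for all $t\ge1$: $\gamma_{t+1}-\gamma_t\le\beta_t$ and $\gamma_t/\alpha_t\le\gamma_{t+1}/\alpha_{t+1}$. *)

(* Defs.v *)
From HB Require Import structures.
From mathcomp Require Import all_boot all_order all_algebra.
From mathcomp Require Import all_classical all_reals all_analysis.

Set Implicit Arguments.
Unset Strict Implicit.
Unset Printing Implicit Defensive.

Import Order.TTheory GRing.Theory Num.Theory.
Import numFieldNormedType.Exports.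

Local Open Scope classical_set_scope.
Local Open Scope ring_scope.

Section EuclideanSpace.
Context {R : realType} {d : nat}.
Implicit Types (u v x y : 'rV[R]_d) (f : 'rV[R]_d -> R) (X : set 'rV[R]_d).

Definition dotp u v : R := \sum_(i < d) u 0 i * v 0 i.

(* An arbitrary norm on R^d. The topology (differentiability, closedness) is
   the library's one on 'rV[R]_d, which in finite dimension is the topology of
   every norm. *)
Record is_norm (nrm : 'rV[R]_d -> R) : Prop := IsNorm {
  is_norm_triangle : forall x y, nrm (x + y) <= nrm x + nrm y ;
  is_norm_scale : forall (k : R) x, nrm (k *: x) = `|k| * nrm x ;
  is_norm_eq0 : forall x, nrm x = 0 -> x = 0 }.

Definition dual_norm (nrm : 'rV[R]_d -> R) u : R :=
  sup [set dotp u x | x in [set x | nrm x <= 1]].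

(* Meaningful at the points where f is differentiable. *)
Definition gradient f x : 'rV[R]_d :=
  \row_(i < d) 'd (f : 'rV[R]_d -> R^o) x (delta_mx 0 i).

Definition bregman f x y : R := f x - f y - dotp (gradient f y) (x - y).

Definition strictly_convex_function X f : Prop :=
  forall x y (k : R), X x -> X y -> x != y -> 0 < k -> k < 1 ->
    f (k *: x + (1 - k) *: y) < k * f x + (1 - k) * f y.

(* Continuously differentiable at the points of X, which may have empty
   interior or be the whole space. *)
Definition C1_on X f : Prop :=
  (forall x, X x -> differentiable (f : 'rV[R]_d -> R^o) x) /\
  {within X, continuous (gradient f)}.

Definition strongly_convex1 X (nrm : 'rV[R]_d -> R) f : Prop :=
  forall x y, X x -> X y -> nrm (x - y) ^+ 2 / 2 <= bregman f x y.

Definition is_argmin X f x : Prop := X x /\ forall y, X y -> f x <= f y.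

End EuclideanSpace.

Section RandomElements.
Context {R : realType}.

Definition mutually_independent d d' (Omega : measurableType d)
    (Xi : measurableType d') (P : probability Omega R)
    (I : set nat) (xi : nat -> {RV P >-> Xi}) : Prop :=
  forall (J : seq nat) (B : nat -> set Xi),
    uniq J -> (forall j, j \in J -> I j) -> (forall j, measurable (B j)) ->
    P (\bigcap_(j in [set` J]) (xi j @^-1` B j)) =
    (\prod_(j <- J) fine (P (xi j @^-1` B j)))%:E.

(* Independent samples xi 1, xi 2, ... of a law nu; xi 0 is unused. *)
Definition iid_samples d d' (Omega : measurableType d)
    (Xi : measurableType d') (P : probability Omega R)
    (nu : probability Xi R) (xi : nat -> {RV P >-> Xi}) : Prop :=
  mutually_independent [set t | (1 <= t)%N] xi /\
  (forall t, (1 <= t)%N -> forall B, measurable B ->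
     distribution P (xi t) B = nu B).

Definition has_expectation d (Xi : measurableType d) (nu : probability Xi R)
    (h : Xi -> R) (m : R) : Prop :=
  nu.-integrable [set: Xi] (EFin \o h) /\ ('E_nu[h] = m%:E)%E.

(* Joint measurability of (z, x) |-> g z x on Xi * X. The library puts no
   sigma-algebra on 'rV[R]_k; R^k is read as k.-tuple R, whose product
   sigma-algebra is the Borel one. *)
Definition jointly_measurable d (Xi : measurableType d) (k : nat)
    (X : set 'rV[R]_k) (g : Xi -> 'rV[R]_k -> 'rV[R]_k) : Prop :=
  let vec (s : k.-tuple R) : 'rV[R]_k := \row_(i < k) tnth s i in
  forall j : 'I_k,
    measurable_fun [set p : Xi * k.-tuple R | X (vec p.2)]
      (fun p : Xi * k.-tuple R => g p.1 (vec p.2) 0 j).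

(* f is the family (f_xi), g z x stands for the stochastic gradient of f_z at
   x. As the f_z are only assumed convex, g z x is a subgradient of f_z
   relative to X; the gradient of f_z at x is one whenever it exists. *)
Record stochastic_objective d (Xi : measurableType d) (nu : probability Xi R)
    (k : nat) (X : set 'rV[R]_k) (f : Xi -> 'rV[R]_k -> R)
    (g : Xi -> 'rV[R]_k -> 'rV[R]_k) (F : 'rV[R]_k -> R) : Prop :=
  StochasticObjective {
  so_convex : forall z, convex_function X (f z) ;
  so_expectation : forall x, X x -> has_expectation nu (f ^~ x) (F x) ;
  so_differentiable :
    forall x, X x -> differentiable (F : 'rV[R]_k -> R^o) x ;
  so_oracle : forall z x y, X x -> X y ->
    f z x + dotp (g z x) (y - x) <= f z y ;
  so_oracle_measurable : jointly_measurable X g ;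
  so_oracle_unbiased : forall x (j : 'I_k), X x ->
    has_expectation nu (fun z => g z x 0 j) (gradient F x 0 j) }.

End RandomElements.

Section Algorithm.
Context {R : realType}.

Definition cumul (alpha : nat -> R) (t : nat) : R :=
  \sum_(1 <= s < t.+1) alpha s.

(* One trajectory of accelerated composite mirror descent, for the sample path
   z 1, z 2, ..., z T. Index 0 is unused. *)
Definition acmd_run (k : nat) (Xi : Type) (X : set 'rV[R]_k)
    (g : Xi -> 'rV[R]_k -> 'rV[R]_k) (H : 'rV[R]_k -> R)
    (alpha beta gamma : nat -> R) (T : nat) (x1 xag1 : 'rV[R]_k)
    (z : nat -> Xi) (x xmd xag : nat -> 'rV[R]_k) : Prop :=
  let A := cumul alpha in
  [/\ x 1%N = x1, xag 1%N = xag1 &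
   forall t, (1 <= t <= T)%N ->
   [/\ xmd t = (A t.-1 / A t) *: xag t + (alpha t / A t) *: x t,
       is_argmin X
         (fun y => alpha t * dotp (g (z t) (xmd t)) y + beta t * H y
                   + gamma t * bregman H y (x t)) (x t.+1) &
       xag t.+1 = (A t.-1 / A t) *: xag t + (alpha t / A t) *: x t.+1]].

Definition alpha_step (a n : R) (t : nat) : R := a * t%:R `^ n.
Definition beta_step (b n mu : R) (t : nat) : R := b * mu * t%:R `^ n.
Definition gamma_step (c n mu : R) (t : nat) : R :=
  c * mu * t%:R `^ (n + 1) / (n + 1).

Definition admissible_steps (alpha beta gamma : nat -> R) : Prop :=
  forall t, (1 <= t)%N ->
    gamma t.+1 - gamma t <= beta t /\
    gamma t / alpha t <= gamma t.+1 / alpha t.+1.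

End Algorithm.

(* Main.v *)
(** The iteration contracts the potential
    [A t * (F (xag t.+1) - F xF) + ga t.+1 * D^H (xF, x t.+1)]: convexity and
    smoothness of [F] at [xmd t], combined with the optimality condition of the
    mirror step, bound its increment by [be t * D ^ 2], a noise term linear in
    the noise [delta t], the term [al t ^ 2 / ga t * |delta t|_* ^ 2], and
    [(L * al t ^ 2 / (2 * A t) - ga t / 4)^+ * D ^ 2]. The last one vanishes once
    [t] exceeds a constant times the square root of [L / mu]. The point [x t]
    depends on the samples before [t] only, so the linear noise term has
    expectation 0 by independence and Fubini; for this the iterates have to be
    measurable, which holds because the mirror step is Lipschitz in its linear
    term. With polynomial steps [A T] is of order [T ^ (n + 1)], and all the sums
    reduce to the sum of [t ^ (n - 1)], of order [T ^ n / n]. *)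

Require Import Defs.
From HB Require Import structures.
From mathcomp Require Import all_boot all_order all_algebra.
From mathcomp Require Import all_classical all_reals all_analysis.
From mathcomp Require Import measurable_realfun.
From mathcomp Require Import ring lra.

Set Implicit Arguments.
Unset Strict Implicit.
Unset Printing Implicit Defensive.

Import Order.TTheory GRing.Theory Num.Theory.
Import numFieldNormedType.Exports.

Local Open Scope classical_set_scope.
Local Open Scope ring_scope.

(** * Norms and inner products *)

Section DotProduct.
Context {R : realType} {k : nat}.
Implicit Types u v w x : 'rV[R]_k.

(** The steps are chosen without knowledge of [L], so in early iterations [ga t / 4] is too small to
    absorb the curvature of [F]. The bounded diameter pays for these iterations, and this is the
    origin of the last term of the rate. Regularizing with [be t * H] costs [be t * D ^ 2], but it
    raises the weight of the divergence at the new point from [ga t] to [ga t + be t]; this is what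
    allows [ga] to grow along the potential. The noise is paired with [x t.+1 - xF], and [x t.+1]
    depends on the current sample. Splitting this vector into [x t - xF] and [x t.+1 - x t] isolates
    a part of expectation 0; the strong convexity of [H] controls the other one. On the
    probabilistic side, the past is [Omega] itself with the sigma-algebra generated by the earlier
    samples. The identity of [Omega] and the fresh sample then have a product law, and inner
    integrals take the place of conditional expectations. *)

Lemma dotpC u v : dotp u v = dotp v u.
Proof. by apply: eq_bigr => i _; rewrite mulrC. Qed.

Lemma dotpDr u v w : dotp u (v + w) = dotp u v + dotp u w.
Proof. by rewrite /dotp -big_split; apply: eq_bigr => i _; rewrite !mxE mulrDr. Qed.

Lemma dotpZr a u v : dotp u (a *: v) = a * dotp u v.
Proof. by rewrite /dotp mulr_sumr; apply: eq_bigr => i _; rewrite !mxE mulrCA. Qed.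

Lemma dotp0r u : dotp u 0 = 0.
Proof. by rewrite /dotp big1// => i _; rewrite mxE mulr0. Qed.

Lemma dotpNr u v : dotp u (- v) = - dotp u v.
Proof. by rewrite -scaleN1r dotpZr mulN1r. Qed.

Lemma dotpBr u v w : dotp u (v - w) = dotp u v - dotp u w.
Proof. by rewrite dotpDr dotpNr. Qed.

Lemma dotpDl u v w : dotp (u + v) w = dotp u w + dotp v w.
Proof. by rewrite ![dotp _ w]dotpC dotpDr. Qed.

Lemma dotpZl a u v : dotp (a *: u) v = a * dotp u v.
Proof. by rewrite ![dotp _ v]dotpC dotpZr. Qed.

Lemma dotpBl u v w : dotp (u - v) w = dotp u w - dotp v w.
Proof. by rewrite ![dotp _ w]dotpC dotpBr. Qed.

Lemma coord_le_norm u i : `|u 0 i| <= `|u|.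
Proof.
rewrite [`|u|]mx_normrE.
exact: (le_bigmax _ (fun ij : 'I_1 * 'I_k => `|u ij.1 ij.2|) (0, i)).
Qed.

Lemma norm_dotp_le u x : `|dotp u x| <= k%:R * `|u| * `|x|.
Proof.
apply: (le_trans (ler_norm_sum _ _ _)).
apply: (@le_trans _ _ (\sum_(i < k) `|u| * `|x|)); last first.
  by rewrite sumr_const card_ord -mulrA mulr_natl.
by apply: ler_sum => i _; rewrite normrM ler_pM ?coord_le_norm.
Qed.

Lemma diff_gradient (f : 'rV[R]_k -> R) x v :
  differentiable (f : 'rV[R]_k -> R^o) x ->
  'd (f : 'rV[R]_k -> R^o) x v = dotp (gradient f x) v.
Proof.
move=> df; rewrite {1}(row_sum_delta v) linear_sum.
by apply: eq_bigr => i _; rewrite linearZ mxE mulrC.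
Qed.

Lemma bregmanD (f : 'rV[R]_k -> R) x y :
  bregman f x y + bregman f y x = dotp (gradient f x - gradient f y) (x - y).
Proof.
rewrite /bregman; move: (gradient f x) (gradient f y) => gx gy.
rewrite !dotpBl !dotpBr.
move: (dotp gx x) (dotp gx y) (dotp gy x) (dotp gy y) (f x) (f y) => ? ? ? ? ? ?.
ring.
Qed.

End DotProduct.

Section Norms.
Context {R : realType} {k : nat} (nrm : 'rV[R]_k -> R) (nrmP : is_norm nrm).
Implicit Types u v w x y : 'rV[R]_k.

Lemma is_norm0 : nrm 0 = 0.
Proof. by rewrite -(scale0r (0 : 'rV[R]_k)) is_norm_scale// normr0 mul0r. Qed.

Lemma is_normN x : nrm (- x) = nrm x.
Proof. by rewrite -scaleN1r is_norm_scale// normrN1 mul1r. Qed.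

Lemma is_norm_distC x y : nrm (x - y) = nrm (y - x).
Proof. by rewrite -is_normN opprB. Qed.

Lemma is_norm_ge0 x : 0 <= nrm x.
Proof.
have := is_norm_triangle nrmP x (- x).
by rewrite subrr is_norm0 is_normN -mulr2n pmulrn_lge0.
Qed.

Lemma is_norm_le_norm : exists2 K : R, 0 < K & forall x, nrm x <= K * `|x|.
Proof.
(* The summand 1 keeps the constant positive in dimension 0, where the sum is empty. *)
exists (1 + \sum_(i < k) nrm (delta_mx 0 i)).
  by rewrite ltr_pwDl// sumr_ge0// => i _; exact: is_norm_ge0.
move=> x; apply: (@le_trans _ _ (\sum_(i < k) nrm (delta_mx 0 i) * `|x|)).
  rewrite {1}(row_sum_delta x).
  elim/big_ind2: _ => [|a b c d h1 h2|i _]; first by rewrite is_norm0.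
    exact: le_trans (is_norm_triangle nrmP _ _) (lerD h1 h2).
  by rewrite is_norm_scale// mulrC ler_wpM2l ?is_norm_ge0 ?coord_le_norm.
by rewrite -mulr_suml ler_wpM2r// lerDr.
Qed.

Lemma is_norm_continuous : continuous (nrm : 'rV[R]_k -> R^o).
Proof.
have [K K0 nK] := is_norm_le_norm.
move=> x; apply/(@cvgrPdist_le _ R^o _ (nbhs x) (nbhs_filter x)) => /= e e0.
near=> y.
have xyK : K * `|x - y| <= e.
  rewrite mulrC -ler_pdivlMr//; near: y.
  apply/nbhs_ballP; exists (e / K) => /=; first by rewrite divr_gt0.
  by move=> y; rewrite -ball_normE => /ltW.
rewrite ler_norml lerNl opprB !lerBlDl; apply/andP; split.
  have := is_norm_triangle nrmP x (y - x); rewrite addrC subrK => /le_trans; apply.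
  by rewrite lerD2l -is_normN opprB (le_trans (nK _)).
have := is_norm_triangle nrmP y (x - y); rewrite addrC subrK => /le_trans; apply.
by rewrite lerD2l (le_trans (nK _)).
Unshelve. all: by end_near. Qed.

(* Compactness of the unit sphere of the sup norm. *)
Lemma norm_le_is_norm : exists2 K : R, 0 < K & forall x, `|x| <= K * nrm x.
Proof.
pose S := [set x : 'rV[R]_k | `|x| = 1].
(* The sphere is empty only in dimension 0, where every vector is 0. *)
have [S0|] := pselect (S !=set0); last first.
  move=> /set0P/negP/negPn/eqP S0; exists 1 => // x.
  have [->|x0] := eqVneq x 0; first by rewrite normr0 is_norm0 mulr0.
  have : S (`|x|^-1 *: x).
    by rewrite /S/= normrZ normfV normr_id mulVf// normr_eq0.
  by rewrite S0.
have cS : compact S.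
  apply: bounded_closed_compact.
    exists 1; split => // M M1 x /= ->; exact: ltW.
  apply: (@closed_comp _ _ (fun x : 'rV[R]_k => `|x|) [set 1]).
    by move=> x _; exact: norm_continuous.
  exact: closed_eq.
have [p pS pmin] := @EVT_min_rV R k nrm S S0 cS
  (continuous_subspaceT is_norm_continuous).
have p0 : 0 < nrm p.
  rewrite lt_neqAle is_norm_ge0 andbT eq_sym; apply/eqP => /(is_norm_eq0 nrmP) p0.
  by move: pS; rewrite inE /S/= p0 normr0 => /esym/eqP; rewrite oner_eq0.
exists (nrm p)^-1; first by rewrite invr_gt0.
move=> x; have [->|x0] := eqVneq x 0; first by rewrite normr0 is_norm0 mulr0.
have nx0 : 0 < `|x| by rewrite normr_gt0.
have := pmin (`|x|^-1 *: x); rewrite inE /S/= normrZ normfV normr_id mulVf ?gt_eqF//.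
move=> /(_ erefl); rewrite is_norm_scale// normfV normr_id => h.
by rewrite mulrC ler_pdivlMr// mulrC -ler_pdivlMr// mulrC.
Qed.

(** A [sup] bounds its set only if that set is bounded above. Here this rests on finite dimension,
    through the comparison of [nrm] with the sup norm. *)
Lemma dual_norm_has_sup u : has_sup [set dotp u x | x in [set x | nrm x <= 1]].
Proof.
split; first by exists (dotp u 0), 0 => //=; rewrite is_norm0.
have [K K0 nK] := norm_le_is_norm.
exists (k%:R * `|u| * K) => _ [x /= x1 <-].
rewrite (le_trans (ler_norm _))// (le_trans (norm_dotp_le _ _))//.
by rewrite ler_wpM2l// ?mulr_ge0// (le_trans (nK _))// ler_piMr// ltW.
Qed.

Lemma dotp_le_dual_norm u x : dotp u x <= dual_norm nrm u * nrm x.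
Proof.
have [->|x0] := eqVneq x 0; first by rewrite dotp0r is_norm0 mulr0.
have nx0 : 0 < nrm x.
  rewrite lt_neqAle is_norm_ge0 andbT eq_sym.
  by apply: contra x0 => /eqP /(is_norm_eq0 nrmP) ->.
rewrite -ler_pdivrMr// mulrC -dotpZr.
apply: (ub_le_sup (dual_norm_has_sup u).2); exists ((nrm x)^-1 *: x) => //=.
by rewrite is_norm_scale// ger0_norm ?invr_ge0 ?is_norm_ge0// mulVf// gt_eqF.
Qed.

Lemma dual_norm_ge0 u : 0 <= dual_norm nrm u.
Proof.
rewrite -(dotp0r u).
by apply: (ub_le_sup (dual_norm_has_sup u).2); exists 0 => //=; rewrite is_norm0.
Qed.

Lemma norm_dotp_le_dual u x : `|dotp u x| <= dual_norm nrm u * nrm x.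
Proof.
rewrite ler_norml dotp_le_dual_norm andbT lerNl -dotpNr.
by rewrite (le_trans (dotp_le_dual_norm _ _))// is_normN.
Qed.

Lemma dual_norm_triangle u v :
  dual_norm nrm (u + v) <= dual_norm nrm u + dual_norm nrm v.
Proof.
apply: ge_sup; first exact: (dual_norm_has_sup _).1.
move=> _ [x /= x1 <-]; rewrite dotpDl; apply: lerD;
  by rewrite (le_trans (dotp_le_dual_norm _ _))// ler_piMr// dual_norm_ge0.
Qed.

Lemma dual_norm_le_norm :
  exists2 K : R, 0 < K & forall u, dual_norm nrm u <= K * `|u|.
Proof.
have [K K0 nK] := norm_le_is_norm.
exists (k.+1%:R * K); first by rewrite mulr_gt0.
move=> u; apply: ge_sup; first exact: (dual_norm_has_sup _).1.
move=> _ [x /= x1 <-].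
rewrite (le_trans (ler_norm _))// (le_trans (norm_dotp_le _ _))//.
rewrite mulrAC -mulrA [leRHS]mulrAC -[leRHS]mulrA; apply: ler_pM => //.
- by rewrite ler_nat.
- by rewrite mulrC ler_wpM2l// (le_trans (nK _))// ler_piMr// ltW.
Qed.

(** This quantitative continuity makes the dual norm of the noise measurable. *)
Lemma dual_norm_lipschitz : exists2 K : R, 0 < K &
  forall u v, `|dual_norm nrm u - dual_norm nrm v| <= K * `|u - v|.
Proof.
have [K K0 dK] := dual_norm_le_norm; exists K => // u v.
rewrite ler_norml lerNl opprB !lerBlDl; apply/andP; split.
  have := dual_norm_triangle u (v - u); rewrite addrC subrK => /le_trans; apply.
  by rewrite lerD2l distrC dK.
have := dual_norm_triangle v (u - v); rewrite addrC subrK => /le_trans; apply.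
by rewrite lerD2l dK.
Qed.

End Norms.

(** * The mirror step *)

Section Prox.
Context {R : realType} {k : nat} (X : set 'rV[R]_k).
Implicit Types (u v p q : 'rV[R]_k) (H : 'rV[R]_k -> R).

Lemma convex_setD p u (s : R) : convex_set X -> X p -> X u -> 0 <= s -> s <= 1 ->
  X (p + s *: (u - p)).
Proof.
move=> cX Xp Xu s0 s1.
have := cX u p (Itv01 s0 s1); rewrite !inE => /(_ Xu Xp).
move=> h.
suff -> : p + s *: (u - p) = s *: u + (1 - s) *: p by exact: h.
by rewrite scalerBr scalerBl scale1r addrCA.
Qed.

(** Divide by [s] and let [s] tend to 0 from the right. The limit is one-sided because [p] may lie
    on the boundary of the constraint set. *)
Lemma directional_limit_ge0 H p v (a m : R) :
  differentiable (H : 'rV[R]_k -> R^o) p ->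
  (forall s, 0 < s -> s <= 1 -> 0 <= s * a + m * (H (p + s *: v) - H p)) ->
  0 <= a + m * dotp (gradient H p) v.
Proof.
move=> dH h; rewrite -diff_gradient// -deriveE//.
have dv : derivable (H : 'rV[R]_k -> R^o) p v by exact: diff_derivable.
have Hl : (a + m * (s^-1 *: ((H (s *: v + p) : R^o) - H p) : R) @[s --> (0 : R)^'+] -->
           a + m * 'D_v (H : 'rV[R]_k -> R^o) p).
  apply: cvgD; first exact: cvg_cst.
  apply: cvgM; first exact: cvg_cst.
  exact: cvg_dnbhs_at_right dv.
rewrite -(cvg_lim _ Hl)//; apply: limr_ge; first by apply/cvg_ex; eexists; exact: Hl.
near=> s.
have s0 : 0 < s by [].
have s1 : s <= 1 by near: s; exact: nbhs_right_le.
have := h s s0 s1; rewrite -(pmulr_rge0 (_ : R) (_ : 0 < s^-1)) ?invr_gt0//.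
rewrite mulrDr mulKf ?gt_eqF// mulrCA [s *: v + p]addrC.
by [].
Unshelve. all: by end_near. Qed.

(** Up to a constant, [bregman H y q] is [H y] minus a linear form, so the objective is a linear
    form plus [(be + ga) * H]. Only this last term has to be differentiated along the segment from
    [p] to [u]. *)
Lemma prox_first_order H (al be ga : R) (g p q : 'rV[R]_k) u :
  convex_set X -> (forall y, X y -> differentiable (H : 'rV[R]_k -> R^o) y) ->
  is_argmin X (fun y => al * dotp g y + be * H y + ga * bregman H y q) p ->
  X u ->
  0 <= dotp (al *: g - ga *: gradient H q) (u - p) +
       (be + ga) * dotp (gradient H p) (u - p).
Proof.
move=> cX dH [Xp pmin] Xu.
apply: directional_limit_ge0; first exact: dH.
move=> s s0 s1; have := pmin _ (convex_setD cX Xp Xu (ltW s0) s1).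
rewrite -subr_ge0 /bregman; move: (gradient H q) (H (p + s *: (u - p))) => gq Hs.
rewrite !dotpBl !dotpBr !dotpZl !dotpDr !dotpZr !dotpBr.
move: (dotp g u) (dotp g p) (dotp gq u) (dotp gq p) (dotp gq q) (H p) (H q).
move=> a b c d e Hp Hq /le_trans; apply; rewrite le_eqVlt; apply/orP; left.
by apply/eqP; ring.
Qed.

End Prox.

(** * One iteration along a fixed sample path *)

Section MirrorStep.
Context {R : realType} {k : nat} (X : set 'rV[R]_k) (nrm : 'rV[R]_k -> R).
Context (F H : 'rV[R]_k -> R).
Hypotheses (cX : convex_set X) (nrmP : is_norm nrm).
Hypothesis dH : forall y, X y -> differentiable (H : 'rV[R]_k -> R^o) y.
Hypothesis Hsc : strongly_convex1 X nrm H.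
Implicit Types u p q : 'rV[R]_k.

Let prox (al be ga : R) (g q y : 'rV[R]_k) : R :=
  al * dotp g y + be * H y + ga * bregman H y q.

(** The variational inequality at [p], rewritten with the three-point identity of Bregman
    divergences. As [be * H] is not linearized, it contributes its own divergence
    [be * bregman H u p]. *)
Lemma mirror_step (al be ga : R) (g p q u : 'rV[R]_k) :
  is_argmin X (prox al be ga g q) p -> X u ->
  al * dotp g (p - u) <=
  be * (H u - H p) + ga * bregman H u q - (ga + be) * bregman H u p
  - ga * bregman H p q.
Proof.
move=> pmin Xu; rewrite -subr_ge0; have := prox_first_order cX dH pmin Xu.
rewrite /bregman; move: (gradient H p) (gradient H q) => gp gq.
rewrite !dotpBl !dotpBr !dotpZl.
move: (dotp g u) (dotp g p) (dotp gq u) (dotp gq p) (dotp gq q) => a b c d e.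
move: (dotp gp u) (dotp gp p) (H u) (H p) (H q) => a' b' Hu Hp Hq.
move=> /le_trans; apply; rewrite le_eqVlt; apply/orP; left.
by apply/eqP; ring.
Qed.

(** Each minimizer is tested against the other one and the two variational inequalities are added.
    Strong convexity makes [gradient H] strongly monotone, which bounds
    [(be + ga) * nrm (p - p') ^+ 2] by the pairing of [p' - p] with the difference of the linear
    terms. *)
Lemma prox_lipschitz (al be ga : R) (g p q g' p' q' : 'rV[R]_k) :
  is_argmin X (prox al be ga g q) p -> is_argmin X (prox al be ga g' q') p' ->
  0 < be + ga ->
  (be + ga) * nrm (p - p') <=
  dual_norm nrm ((al *: g - ga *: gradient H q) -
                 (al *: g' - ga *: gradient H q')).
Proof.
move=> pm pm' bg0.
have h1 := prox_first_order cX dH pm pm'.1.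
have h2 := prox_first_order cX dH pm' pm.1.
have h3 := Hsc pm.1 pm'.1.
have h4 := Hsc pm'.1 pm.1.
have h5 := bregmanD H p p'.
move: h1 h2 h5.
move: (al *: g - _) (al *: g' - _) => c c' h1 h2 h5.
have h6 := dotp_le_dual_norm nrmP (c - c') (p' - p).
have h7 : (be + ga) * nrm (p - p') ^+ 2 <= dual_norm nrm (c - c') * nrm (p - p').
  rewrite [X in _ <= _ * X](is_norm_distC nrmP).
  apply: le_trans h6; apply: (@le_trans _ _ ((be + ga) * (bregman H p p' + bregman H p' p))).
    rewrite ler_pM2l//; apply: le_trans (lerD h3 h4).
    rewrite [nrm (p' - p)](is_norm_distC nrmP) -splitr.
    by [].
  rewrite h5.
  move: h1 h2; move: (gradient H p) (gradient H p') => gp gp'.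
  rewrite -(opprB p p') !dotpNr !dotpBl.
  move: (dotp c _) (dotp c' _) (dotp gp _) (dotp gp' _) => *.
  lra.
have [n0|n0] := eqVneq (nrm (p - p')) 0.
  by rewrite n0 mulr0 (dual_norm_ge0 nrmP).
have np : 0 < nrm (p - p') by rewrite lt_neqAle eq_sym n0 (is_norm_ge0 nrmP).
by rewrite -(ler_pM2r np) -mulrA -expr2.
Qed.

(** Smoothness is used between [ag'] and [md], which differ by [al / (A + al)] times [x' - x];
    convexity is used from [md] towards [ag] with weight [A] and towards [xF] with weight [al]. The
    mirror step leaves [- ga / 2 * nrm (x' - x) ^+ 2]: one half of it pays for the noise, the other
    for the curvature. *)
Lemma acmd_step (L D al be ga A : R) (g x ag x' xF : 'rV[R]_k) :
  (forall y z, X y -> X z -> F y + dotp (gradient F y) (z - y) <= F z) ->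
  (forall y z, X y -> X z -> bregman F y z <= L / 2 * nrm (y - z) ^+ 2) ->
  (forall y z, X y -> X z -> nrm (y - z) ^+ 2 <= D ^+ 2) ->
  (forall y, X y -> H xF - H y <= D ^+ 2) ->
  0 < al -> 0 <= be -> 0 < ga -> 0 <= A ->
  X x -> X ag -> X xF ->
  let md : 'rV[R]_k := (A / (A + al)) *: ag + (al / (A + al)) *: x in
  let ag' : 'rV[R]_k := (A / (A + al)) *: ag + (al / (A + al)) *: x' in
  let delta : 'rV[R]_k := g - gradient F md in
  is_argmin X (prox al be ga g x) x' ->
  [/\ X md, X ag' &
  (A + al) * (F ag' - F xF) + (ga + be) * bregman H xF x' <=
  A * (F ag - F xF) + ga * bregman H xF x + be * D ^+ 2
  - al * dotp delta (x - xF) + al ^+ 2 / ga * dual_norm nrm delta ^+ 2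
  + Num.max 0 (L * al ^+ 2 / (2 * (A + al)) - ga / 4) * D ^+ 2].
Proof.
move=> gradF smF diam HD al0 be0 ga0 A0 Xx Xag XxF md ag' delta pmin.
have Xx' := pmin.1.
have S0 : 0 < A + al by rewrite ltr_wpDl.
have Xmix y z : X y -> X z -> X ((A / (A + al)) *: y + (al / (A + al)) *: z).
  move=> Xy Xz; have -> : A / (A + al) = 1 - al / (A + al).
    by field; rewrite gt_eqF.
  rewrite scalerBl scale1r -addrA addrC -addrA [_ + y]addrC addrCA.
  rewrite [X in y + X]addrC -scalerBr; apply: convex_setD => //.
    by rewrite divr_ge0// ltW.
  by rewrite ler_pdivrMr// mul1r lerDr.
have Xmd : X md by exact: Xmix.
have Xag' : X ag' by exact: Xmix.
split => //.
have e1 := smF _ _ Xag' Xmd.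
have e2 := gradF _ _ Xmd Xag.
have e3 := gradF _ _ Xmd XxF.
have e4 := mirror_step pmin XxF.
have e5 := norm_dotp_le_dual nrmP delta (x' - x).
have e6 := HD _ Xx'.
have e7 := Hsc Xx' Xx.
have e8 := diam _ _ Xx' Xx.
have dag : ag' - md = (al / (A + al)) *: (x' - x).
  by rewrite /ag' /md opprD addrACA subrr add0r scalerBr.
have nag : nrm (ag' - md) = al / (A + al) * nrm (x' - x).
  by rewrite dag (is_norm_scale nrmP) ger0_norm// divr_ge0// ltW.
have mdE u : dotp u md = A / (A + al) * dotp u ag + al / (A + al) * dotp u x.
  by rewrite /md dotpDr !dotpZr.
rewrite /bregman in e1; move: e1 e2 e3 e4 e5; rewrite nag dag /delta.
clearbody md ag'; move: (gradient F md) (mdE (gradient F md)) => gF mdgF.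
rewrite (dotpZr (al / (A + al)) gF (x' - x)) (dotpBr gF x' x) (dotpBr gF ag md).
rewrite (dotpBr gF xF md) (dotpBr g x' xF) (dotpBr (g - gF) x' x).
rewrite (dotpBr (g - gF) x xF).
rewrite (dotpBl g gF x') (dotpBl g gF x) (dotpBl g gF xF); move: mdgF.
move: (g - gF) => delta' mdgF e1 e2 e3 e4 e5.
move: (dual_norm_ge0 nrmP delta') (is_norm_ge0 nrmP (x' - x)) e7 e8 e5 e1 e4.
move: (dual_norm nrm delta') (nrm (x' - x)) (bregman H x' x) (bregman H xF x)
  (bregman H xF x') => dn N Bx'x BFx BFx'.
move: mdgF e2 e3.
move: (dotp g x') (dotp g x) (dotp g xF) (dotp gF x') (dotp gF x) (dotp gF xF)
  (dotp gF md) (dotp gF ag) => gx' gx gxF fx' fx fxF fmd fag.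
move: e6.
move: (F ag') (F md) (F ag) (F xF) (H xF) (H x') => Fag' Fmd Fag FF HF Hx'.
move=> e6 mdgF e2 e3 dn0 N0 e7 e8 e5 e1 e4.
set M := Num.max 0 _.
(* The sign of the coefficient is unknown: pass to its positive part, then bound the distance by the
   diameter. *)
have hM : (L * al ^+ 2 / (2 * (A + al)) - ga / 4) * N ^+ 2 <= M * D ^+ 2.
  apply: (@le_trans _ _ (M * N ^+ 2)).
    by rewrite ler_wpM2r ?sqr_ge0// /M le_max lexx orbT.
  by rewrite ler_wpM2l// /M le_max lexx.
(* Young's inequality, weighted so that it consumes exactly [ga / 4 * N ^+ 2]. *)
have hyoung : al * (dn * N) <= al ^+ 2 / ga * dn ^+ 2 + ga / 4 * N ^+ 2.
  rewrite -subr_ge0.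
  have -> : al ^+ 2 / ga * dn ^+ 2 + ga / 4 * N ^+ 2 - al * (dn * N) =
    (al * dn - ga / 2 * N) ^+ 2 / ga by field; rewrite gt_eqF.
  by rewrite divr_ge0 ?sqr_ge0// ltW.
have h5 : - al * (gx' - fx' - (gx - fx)) <= al * (dn * N).
  rewrite mulNr -mulrN ler_pM2l//; apply: le_trans e5.
  by rewrite -normrN ler_norm.
have h6 : be * (HF - Hx') <= be * D ^+ 2 by rewrite ler_wpM2l.
have h7 : ga * (N ^+ 2 / 2) <= ga * Bx'x by rewrite ler_wpM2l// ltW.
have h2 : A * (Fmd + (fag - fmd)) <= A * Fag by rewrite ler_wpM2l.
have h3 : al * (Fmd + (fxF - fmd)) <= al * FF by rewrite ler_wpM2l// ltW.
have h1 : (A + al) * (Fag' - Fmd) - al * (fx' - fx) <=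
    L * al ^+ 2 / (2 * (A + al)) * N ^+ 2.
  have -> : (A + al) * (Fag' - Fmd) - al * (fx' - fx) =
      (A + al) * (Fag' - Fmd - al / (A + al) * (fx' - fx)).
    by field; rewrite gt_eqF.
  apply: le_trans (ler_wpM2l (ltW S0) e1) _.
  rewrite le_eqVlt; apply/orP; left; apply/eqP.
  by field; rewrite gt_eqF.
(* By the choice of [md], all the terms in the gradient at [md] that come from convexity and
   smoothness cancel, except the pairing with [x' - xF]. *)
have mdE' : (A + al) * fmd = A * fag + al * fx.
  by rewrite mdgF; field; rewrite gt_eqF.
move: hM hyoung h1; set c1 := L * al ^+ 2 / _; set c2 := al ^+ 2 / ga.
move=> hM hyoung h1.
move: hM hyoung h1 h5 h6 h7 h2 h3 e4 mdE'.
clearbody M c1 c2; lra.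
Qed.

End MirrorStep.

(** * Polynomial step-sizes *)

Section PolynomialSums.
Context {R : realType} (n : R) (n0 : 0 < n).

(* With [t / (t - 1) = exp y] one has [y >= 1 / t], hence
   [(t / (t - 1)) ^ n >= 1 + n / t]. *)
Lemma powR_pred_le (t : nat) : (1 <= t)%N ->
  t%:R `^ n / t%:R <= (n + 1) / n * (t%:R `^ n - t.-1%:R `^ n) :> R.
Proof.
case: t => // -[_|t _] /=.
  rewrite powR1 powR0 ?gt_eqF// subr0 divr1 mulr1 ler_pdivlMr//.
  by rewrite mul1r lerDl.
set x : R := t.+1%:R; set y : R := t.+2%:R.
have x1 : 1 <= x by rewrite /x ler1n.
have yE : y = x + 1 by rewrite /y /x -[t.+2]addn1 natrD.
clearbody x y.
have x0 : 0 < x by lra.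
have y0 : 0 < y by lra.
have ln_le : y^-1 <= ln (y / x).
  have -> : y / x = (1 + (- y^-1))^-1.
    by rewrite yE; field; rewrite !gt_eqF//; lra.
  have h0 : 0 < 1 + - y^-1.
    by rewrite subr_gt0 invf_lt1//; lra.
  rewrite lnV ?posrE// lerNr; apply: le_ln1Dx.
  by rewrite ltrN2 invf_lt1//; lra.
have h : 1 + n / y <= (y / x) `^ n.
  rewrite /powR gt_eqF ?divr_gt0//; apply: le_trans (expR_ge1Dx _).
  by rewrite lerD2l ler_pM2l.
have yn : y `^ n = (y / x) `^ n * x `^ n.
  by rewrite -powRM ?divr_ge0 ?ltW// divfK// gt_eqF.
have xn : 0 < x `^ n by rewrite powR_gt0.
have hx : x `^ n * (1 + n / y) <= y `^ n by rewrite yn mulrC ler_pM2r.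
have ny0 : 0 < 1 + n / y by rewrite ltr_pwDl// divr_ge0// ltW.
have hx' : x `^ n <= y `^ n * (y / (y + n)).
  have -> : y / (y + n) = (1 + n / y)^-1.
    by field; rewrite !gt_eqF ?addr_gt0.
  by rewrite -ler_pdivrMr ?invr_gt0// invrK.
have yn0 : 0 < y `^ n by rewrite powR_gt0.
have y1 : 1 <= y by lra.
(* The factor [(n + 1) / n] suffices because [y + n <= (n + 1) * y] for [y >= 1]. *)
apply: (@le_trans _ _ ((n + 1) / n * (y `^ n * (1 - y / (y + n))))).
  rewrite mulrCA ler_pM2l//.
  have -> : (n + 1) / n * (1 - y / (y + n)) = (n + 1) / (y + n).
    by field; rewrite !gt_eqF ?addr_gt0.
  rewrite ler_pdivlMr ?addr_gt0// mulrC ler_pdivrMr// mulrDl mul1r.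
  by rewrite addrC lerD2r ler_peMr// ltW.
rewrite ler_pM2l ?divr_gt0 ?addr_gt0//.
by rewrite mulrBr mulr1 lerD2l lerN2.
Qed.

(** The bounds of [powR_pred_le] telescope. The cutoff lets one statement serve two sums: [s = T]
    for the noise, and [s] of order [sqrt (L / mu)] for the curvature, where the bound must not grow
    with [T]. *)
Lemma sum_truncated_powR_le (s : R) (T : nat) : 0 <= s ->
  \sum_(1 <= t < T.+1) (if t%:R <= s then t%:R `^ n / t%:R else 0) <=
  (n + 1) / n * Num.min T%:R s `^ n.
Proof.
move=> s0; have Q0 : 0 <= (n + 1) / n by rewrite divr_ge0 ?ltW// ltr_wpDr.
elim: T => [|T IH]; first by rewrite big_geq// mulr_ge0// powR_ge0.
rewrite big_nat_recr//; case: ifPn => [Ts|/= _].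
  have Ts' : T%:R <= s by apply: le_trans Ts; rewrite ler_nat.
  move: IH; rewrite !min_l// => IH.
  apply: le_trans (lerD IH (@powR_pred_le T.+1 isT)) _.
  by rewrite -mulrDr [_ + (_ - _)]addrC subrK.
rewrite addr0; apply: le_trans IH _; rewrite ler_wpM2l//.
have mono : Num.min T%:R s <= Num.min T.+1%:R s.
  by rewrite le_min !ge_min lexx orbT ler_nat leqnSn.
by apply: ge0_ler_powR mono; rewrite ?nnegrE ?le_min ?s0 ?ler0n ?ltW.
Qed.

End PolynomialSums.

(** * Sums of the step-sizes and the constant of the rate *)

Section Rate.
Context {R : realType} (n a b c : R).
Hypotheses (n0 : 0 < n) (a0 : 0 < a) (b0 : 0 < b) (c0 : 0 < c).

Let al := alpha_step a n.
Let A := cumul al.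
(** [K] is chosen so that passing from [t] to [t + 1] increases [t ^ (n + 1)] by at most
    [K * (t + 1) ^ n]. Admissibility gives the second argument of the maximum for [t >= 1]; the
    first one covers the increment from 0 to 1. *)
Let K := Num.max 1 (b * (n + 1) / c).

Let K0 : 0 < K.
Proof. by rewrite /K lt_max ltr01. Qed.

Lemma cumulS (alpha : nat -> R) t : cumul alpha t.+1 = cumul alpha t + alpha t.+1.
Proof. by rewrite /cumul big_nat_recr. Qed.

Lemma alpha_step_gt0 t : (1 <= t)%N -> 0 < al t.
Proof. by move=> t1; rewrite mulr_gt0// powR_gt0// ltr0n. Qed.

Lemma cumul_alpha_step_ge0 t : 0 <= A t.
Proof.
elim: t => [|t IH]; first by rewrite /A /cumul big_geq.
by rewrite /A cumulS addr_ge0// ltW// alpha_step_gt0.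
Qed.

Lemma cumul_alpha_step_gt0 t : (1 <= t)%N -> 0 < A t.
Proof.
case: t => // t _; rewrite /A cumulS ltr_wpDl ?alpha_step_gt0//.
exact: cumul_alpha_step_ge0.
Qed.

Lemma powR_natS (t : nat) : (t%:R : R) `^ (n + 1) = t%:R `^ n * t%:R.
Proof.
rewrite powRD; last by rewrite gt_eqF// addr_gt0.
by rewrite powRr1.
Qed.

Variables (mu : R) (mu0 : 0 < mu).
Let be := beta_step b n mu.
Let ga := gamma_step c n mu.
Hypothesis adm : admissible_steps al be ga.

Lemma gamma_step_gt0 t : (1 <= t)%N -> 0 < ga t.
Proof.
by move=> t1; rewrite divr_gt0 ?addr_gt0// !mulr_gt0// powR_gt0// ltr0n.
Qed.

Lemma beta_step_ge0 t : 0 <= be t.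
Proof. by rewrite !mulr_ge0 ?powR_ge0// ltW. Qed.

(* The admissibility of the steps bounds the increments of [t ^ (n + 1)]. *)
Lemma cumul_alpha_step_ge (T : nat) : a / K * T%:R `^ (n + 1) <= A T.
Proof.
elim: T => [|T IH].
  rewrite powR0 ?mulr0 ?cumul_alpha_step_ge0//.
  by rewrite gt_eqF// addr_gt0.
rewrite /A cumulS -/A -lerBlDl.
apply: le_trans (lerB (lexx _) IH) _.
rewrite -mulrBr -mulrA /al /alpha_step ler_pM2l// mulrC ler_pdivrMr//.
case: T {IH} => [|T].
  rewrite powR0 ?powR1 ?subr0 ?mul1r; last by rewrite gt_eqF// addr_gt0.
  by rewrite /K le_max lexx.
have [h _] := adm (isT : (1 <= T.+1)%N).
apply: (@le_trans _ _ (T.+1%:R `^ n * (b * (n + 1) / c))); last first.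
  apply: ler_pM; rewrite ?powR_ge0//.
  - by rewrite !mulr_ge0 ?invr_ge0// ltW// addr_gt0.
  - by apply: ge0_ler_powR; rewrite ?nnegrE ?ltW// ltr_nat.
  - by rewrite /K le_max lexx orbT.
move: h; rewrite /ga /be /gamma_step /beta_step.
move: (T.+2%:R `^ (n + 1)) (T.+1%:R `^ (n + 1)) (T.+1%:R `^ n) => p q r h.
have -> : p - q = (c * mu * p / (n + 1) - c * mu * q / (n + 1)) * ((n + 1) / (c * mu)).
  by field; rewrite !gt_eqF// ?addr_gt0.
have -> : r * (b * (n + 1) / c) = b * mu * r * ((n + 1) / (c * mu)).
  by field; rewrite !gt_eqF.
by rewrite ler_pM2r// divr_gt0 ?addr_gt0// mulr_gt0.
Qed.

Lemma sum_beta_step T : \sum_(1 <= t < T.+1) be t = b / a * mu * A T.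
Proof.
rewrite /A /cumul mulr_sumr; apply: eq_bigr => t _.
by rewrite /be /beta_step /al /alpha_step; field; rewrite gt_eqF.
Qed.

Lemma sum_alpha2_gamma T :
  \sum_(1 <= t < T.+1) (al t ^+ 2 / ga t) <=
  a ^+ 2 * (n + 1) / (c * mu) * ((n + 1) / n * T%:R `^ n).
Proof.
have -> : \sum_(1 <= t < T.+1) (al t ^+ 2 / ga t) = a ^+ 2 * (n + 1) / (c * mu) *
    \sum_(1 <= t < T.+1) (if t%:R <= T%:R :> R then t%:R `^ n / t%:R else 0).
  rewrite mulr_sumr [LHS]big_nat [RHS]big_nat; apply: eq_bigr => t /andP[t1 tT].
  rewrite ler_nat -ltnS tT /al /ga /alpha_step /gamma_step powR_natS.
  have t0 : 0 < (t%:R : R) by rewrite ltr0n.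
  have tn0 : 0 < (t%:R : R) `^ n by rewrite powR_gt0.
  move: (t%:R : R) (t%:R `^ n) t0 tn0 => p q p0 q0.
  by field; rewrite !gt_eqF// addr_gt0.
rewrite ler_pM2l; last by rewrite divr_gt0 ?mulr_gt0 ?exprn_gt0 ?addr_gt0.
by apply: le_trans (sum_truncated_powR_le n0 T _) _; rewrite ?minxx.
Qed.

(** Solving [a * K * L / 2 * t ^ (n - 1) = ga t / 4] gives [t ^ 2 = M0 * (L / mu)]. *)
Let M0 := 2 * a * K * (n + 1) / c.

(* For [t] beyond the square root of [M0 * L / mu], a quarter of [ga t] absorbs
   the curvature term. *)
Lemma max_curvature_le (L : R) t : 0 < L -> (1 <= t)%N ->
  Num.max 0 (L * al t ^+ 2 / (2 * A t) - ga t / 4) <=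
  a * K * L / 2 *
    (if t%:R <= Num.sqrt (M0 * (L / mu)) then t%:R `^ n / t%:R else 0).
Proof.
move=> L0 t1; have t0 : 0 < (t%:R : R) by rewrite ltr0n.
have tn0 : 0 < (t%:R : R) `^ n by rewrite powR_gt0.
have M00 : 0 < M0 by rewrite divr_gt0// !mulr_gt0// addr_gt0.
(* The lower bound [a / K * t ^ (n + 1)] on [A t] turns the curvature term into a multiple of
   [t ^ (n - 1)]. *)
have curv : L * al t ^+ 2 / (2 * A t) <= a * K * L / 2 * (t%:R `^ n / t%:R).
  rewrite ler_pdivrMr; last by rewrite mulr_gt0// cumul_alpha_step_gt0.
  apply: (@le_trans _ _ (a * K * L / 2 * (t%:R `^ n / t%:R) * (2 * (a / K * t%:R `^ (n + 1))))).
    rewrite powR_natS /al /alpha_step.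
    rewrite le_eqVlt; apply/orP; left; apply/eqP.
    move: (t%:R : R) (t%:R `^ n) t0 tn0 => p q p0 q0.
    by field; rewrite !gt_eqF.
  rewrite ler_wpM2l//; first by rewrite !mulr_ge0 ?invr_ge0 ?powR_ge0// ltW.
  by rewrite ler_pM2l// cumul_alpha_step_ge.
case: ifPn => [_|]; last rewrite -ltNge => st.
  rewrite ge_max; apply/andP; split.
    by rewrite !mulr_ge0 ?invr_ge0 ?powR_ge0// ltW.
  by apply: le_trans curv; rewrite gerBl divr_ge0// ltW// gamma_step_gt0.
rewrite mulr0 ge_max lexx /= subr_le0; apply: le_trans curv _.
have h : M0 * (L / mu) <= t%:R ^+ 2.
  by rewrite -ler_sqrt ?exprn_ge0// sqrtr_sqr ger0_norm ltW.
rewrite /ga /gamma_step powR_natS.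
move: (t%:R : R) (t%:R `^ n) t0 tn0 h => p q p0 q0 h.
have -> : a * K * L / 2 * (q / p) =
    c * mu * q / p / (4 * (n + 1)) * (M0 * (L / mu)).
  by rewrite /M0; field; rewrite !gt_eqF// addr_gt0.
have -> : c * mu * (q * p) / (n + 1) / 4 = c * mu * q / p / (4 * (n + 1)) * p ^+ 2.
  by field; rewrite !gt_eqF// addr_gt0.
by rewrite ler_pM2l// !divr_gt0// !mulr_gt0// addr_gt0.
Qed.

(** Only the iterations up to the cutoff contribute, whence a bound uniform in [T]; the exponent
    [n / 2] is that of the [n]-th power of a square root. *)
Lemma sum_max_curvature_le (L : R) T : 0 < L ->
  \sum_(1 <= t < T.+1) Num.max 0 (L * al t ^+ 2 / (2 * A t) - ga t / 4) <=
  a * K * L / 2 * ((n + 1) / n * (M0 * (L / mu)) `^ (n / 2)).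
Proof.
move=> L0; have M00 : 0 < M0 by rewrite divr_gt0// !mulr_gt0// addr_gt0.
set s := Num.sqrt (M0 * (L / mu)).
apply: (@le_trans _ _ (a * K * L / 2 *
    \sum_(1 <= t < T.+1) (if t%:R <= s then t%:R `^ n / t%:R else 0))).
  rewrite mulr_sumr [leLHS]big_nat [leRHS]big_nat; apply: ler_sum => t /andP[t1 _].
  exact: max_curvature_le.
have aKL : 0 < a * K * L / 2 by rewrite !mulr_gt0.
rewrite ler_pM2l//; apply: le_trans (sum_truncated_powR_le n0 T (sqrtr_ge0 _)) _.
rewrite ler_pM2l ?divr_gt0 ?addr_gt0//.
rewrite [n / 2]mulrC powRrM powR12_sqrt; last first.
  by rewrite ltW// mulr_gt0// divr_gt0.
have smin : Num.min T%:R s <= s by rewrite ge_min lexx orbT.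
by apply: ge0_ler_powR smin; rewrite ?nnegrE ?le_min ?sqrtr_ge0 ?ler0n ?ltW.
Qed.

(** One summand for each term of the rate, in the same order. The factors [K / a] come from the
    lower bound on [A T], and the last denominator offsets the factor [n ^ (n / 2)] contained in the
    last term of the rate. *)
Definition rate_const : R :=
  K * c * n / (a * (n + 1)) + b / a + a * K * (n + 1) ^+ 2 / (c * n ^+ 2)
  + K ^+ 2 * (n + 1) / n / 2 * M0 `^ (n / 2) / n `^ (n / 2).

Lemma rate_const_gt0 : 0 < rate_const.
Proof.
have np : 0 < n + 1 by rewrite addr_gt0.
have M00 : 0 < M0 by rewrite divr_gt0// !mulr_gt0.
rewrite /rate_const !addr_gt0//.
- by rewrite !(mulr_gt0, invr_gt0, exprn_gt0, powR_gt0)//.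
- by rewrite !(mulr_gt0, invr_gt0, exprn_gt0, powR_gt0)//.
- by rewrite !(mulr_gt0, invr_gt0, exprn_gt0, powR_gt0)//.
- by rewrite !(mulr_gt0, invr_gt0, exprn_gt0, powR_gt0)//.
Qed.

Lemma step_sums_le_rate (B D L sigma : R) (T : nat) :
  0 <= B -> 0 < L -> (1 <= T)%N ->
  ga 1%N * B + D ^+ 2 * (\sum_(1 <= t < T.+1) be t)
  + sigma ^+ 2 * (\sum_(1 <= t < T.+1) (al t ^+ 2 / ga t))
  + D ^+ 2 * (\sum_(1 <= t < T.+1)
      Num.max 0 (L * al t ^+ 2 / (2 * A t) - ga t / 4)) <=
  A T * (rate_const * (mu * B / (n * T%:R `^ (n + 1))
         + mu * D ^+ 2
         + n * sigma ^+ 2 / (mu * T%:R)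
         + L * D ^+ 2 / T%:R * (L * n / (mu * T%:R ^+ 2)) `^ (n / 2))).
Proof.
move=> B0 L0 T1.
have np : 0 < n + 1 by rewrite addr_gt0.
have M00 : 0 < M0 by rewrite divr_gt0// !mulr_gt0.
have T0 : 0 < (T%:R : R) by rewrite ltr0n.
have Tn0 : 0 < (T%:R : R) `^ n by rewrite powR_gt0.
have AT := cumul_alpha_step_ge T; rewrite powR_natS in AT.
have AT0 : 0 < A T by rewrite cumul_alpha_step_gt0.
set k1 := K * c * n / (a * (n + 1)).
set k2 := b / a.
set k3 := a * K * (n + 1) ^+ 2 / (c * n ^+ 2).
set k4 := K ^+ 2 * (n + 1) / n / 2 * M0 `^ (n / 2) / n `^ (n / 2).
have k10 : 0 <= k1 by rewrite ltW// !(mulr_gt0, invr_gt0, exprn_gt0, powR_gt0)//.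
have k20 : 0 <= k2 by rewrite ltW// !(mulr_gt0, invr_gt0, exprn_gt0, powR_gt0)//.
have k30 : 0 <= k3 by rewrite ltW// !(mulr_gt0, invr_gt0, exprn_gt0, powR_gt0)//.
have k40 : 0 <= k4 by rewrite ltW// !(mulr_gt0, invr_gt0, exprn_gt0, powR_gt0)//.
have -> : rate_const = k1 + k2 + k3 + k4 by [].
set t1 := mu * B / _; set t2 := mu * D ^+ 2; set t3 := n * _ / _; set t4 := L * _ / _ * _.
have [mu0' n0' L0'] : [/\ 0 <= mu, 0 <= n & 0 <= L] by split; exact: ltW.
have t10 : 0 <= t1 by rewrite !(sqr_ge0, mulr_ge0, invr_ge0, powR_ge0).
have t20 : 0 <= t2 by rewrite !(sqr_ge0, mulr_ge0, invr_ge0, powR_ge0).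
have t30 : 0 <= t3 by rewrite !(sqr_ge0, mulr_ge0, invr_ge0, powR_ge0).
have t40 : 0 <= t4 by rewrite !(sqr_ge0, mulr_ge0, invr_ge0, powR_ge0).
have h1 : ga 1%N * B <= A T * (k1 * t1).
  apply: (@le_trans _ _ (a / K * (T%:R `^ n * T%:R) * (k1 * t1))); last first.
    by apply: ler_wpM2r AT; apply: mulr_ge0.
  rewrite /k1 /t1 /ga /gamma_step powR1 powR_natS le_eqVlt; apply/orP; left.
  move: (T%:R : R) (T%:R `^ n) T0 Tn0 => p q p0 q0; apply/eqP.
  by field; rewrite !gt_eqF.
have h2 : D ^+ 2 * (\sum_(1 <= t < T.+1) be t) <= A T * (k2 * t2).
  rewrite sum_beta_step /k2 /t2 le_eqVlt; apply/orP; left; apply/eqP.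
  by field; rewrite gt_eqF.
have h3 : sigma ^+ 2 * (\sum_(1 <= t < T.+1) (al t ^+ 2 / ga t)) <= A T * (k3 * t3).
  apply: (@le_trans _ _ (a / K * (T%:R `^ n * T%:R) * (k3 * t3))); last first.
    by apply: ler_wpM2r AT; apply: mulr_ge0.
  apply: le_trans (ler_wpM2l (sqr_ge0 _) (sum_alpha2_gamma T)) _.
  rewrite /k3 /t3 le_eqVlt; apply/orP; left.
  move: (T%:R : R) (T%:R `^ n) T0 Tn0 => p q p0 q0; apply/eqP.
  by field; rewrite !gt_eqF.
have h4 : D ^+ 2 * (\sum_(1 <= t < T.+1)
      Num.max 0 (L * al t ^+ 2 / (2 * A t) - ga t / 4)) <= A T * (k4 * t4).
  apply: (@le_trans _ _ (a / K * (T%:R `^ n * T%:R) * (k4 * t4))); last first.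
    by apply: ler_wpM2r AT; apply: mulr_ge0.
  apply: le_trans (ler_wpM2l (sqr_ge0 _) (sum_max_curvature_le T L0)) _.
  have e1 : (M0 * (L / mu)) `^ (n / 2) = M0 `^ (n / 2) * (L / mu) `^ (n / 2).
    by apply: powRM; [exact: ltW|rewrite ltW// divr_gt0].
  have e2 : (L * n / (mu * T%:R ^+ 2)) `^ (n / 2) =
      (L / mu) `^ (n / 2) * n `^ (n / 2) / T%:R `^ n.
    have -> : L * n / (mu * T%:R ^+ 2) = (L / mu) * n * (T%:R ^+ 2)^-1.
      by field; rewrite !gt_eqF.
    rewrite powRM ?invr_ge0 ?exprn_ge0 ?mulr_ge0 ?invr_ge0 ?ltW//.
    rewrite powRM ?divr_ge0 ?ltW//; congr (_ * _).
    have q0 : 0 <= ((T%:R : R) ^+ 2)^-1 by rewrite invr_ge0 exprn_ge0 ?ltW.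
    have : ((T%:R : R) ^+ 2 * (T%:R ^+ 2)^-1) `^ (n / 2) = 1.
      by rewrite divff ?powR1// gt_eqF// exprn_gt0.
    have hT : ((T%:R : R) ^+ 2) `^ (n / 2) = T%:R `^ n.
      by rewrite -powR_mulrn ?ltW// -powRrM; congr (_ `^ _); field.
    rewrite (powRM _ (sqr_ge0 _) q0) hT => h.
    by apply: (mulfI (lt0r_neq0 Tn0)); rewrite h divff// gt_eqF.
  rewrite /k4 /t4 e1 e2.
  have nn0 : 0 < n `^ (n / 2) by rewrite powR_gt0.
  move: (M0 `^ (n / 2)) ((L / mu) `^ (n / 2)) (n `^ (n / 2)) nn0 => x y z z0.
  rewrite le_eqVlt; apply/orP; left.
  move: (T%:R : R) (T%:R `^ n) T0 Tn0 => p q p0 q0; apply/eqP.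
  by field; rewrite !gt_eqF.
apply: le_trans (lerD (lerD (lerD h1 h2) h3) h4) _.
rewrite -!mulrDr ler_pM2l//.
(* The rate is a product of two sums: its diagonal terms are those needed, and the cross terms are
   nonnegative. *)
rewrite !mulrDr !mulrDl.
have := mulr_ge0 k10 t20; have := mulr_ge0 k10 t30; have := mulr_ge0 k10 t40.
have := mulr_ge0 k20 t10; have := mulr_ge0 k20 t30; have := mulr_ge0 k20 t40.
have := mulr_ge0 k30 t10; have := mulr_ge0 k30 t20; have := mulr_ge0 k30 t40.
have := mulr_ge0 k40 t10; have := mulr_ge0 k40 t20; have := mulr_ge0 k40 t30.
clearbody k1 k2 k3 k4 t1 t2 t3 t4; lra.
Qed.

End Rate.

(** * Measurability of vector-valued functions *)

Section MeasurableVectors.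
Context {R : realType} {k : nat} {d : measure_display} {T : measurableType d}.
Implicit Types (u v : T -> 'rV[R]_k) (X : set 'rV[R]_k).

(** Borel measurability of a map into R^k, expressed through its coordinates. *)
Definition measurable_vec v := forall j, measurable_fun [set: T] (fun w => v w 0 j).

Lemma norm_le_coord (u : 'rV[R]_k) (e : R) :
  0 <= e -> (forall j, `|u 0 j| <= e) -> `|u| <= e.
Proof.
move=> e0 ue; rewrite [`|u|]mx_normrE; apply/bigmax_leP; split => // -[i j] _ /=.
by rewrite ord1.
Qed.

(* The set is a countable union of preimages of boxes with rational centers
   and radii [1 / m.+1]. *)
Lemma measurable_locally v (S : set T) : measurable_vec v ->
  (forall w, S w -> exists2 r, 0 < r & forall w', `|v w - v w'| < r -> S w') ->
  measurable S.
Proof.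
move=> mv locS.
pose box (p : 'rV[rat]_k * nat) :=
  [set w | forall j, `|v w 0 j - ratr (p.1 0 j)| < p.2.+1%:R^-1].
have mbox p : measurable (box p).
  have -> : box p = \bigcap_(j in [set: 'I_k]) ((fun w => v w 0 j) @^-1`
      (ball (ratr (p.1 0 j) : R) p.2.+1%:R^-1)).
    apply/seteqP; split => [w bw j _|w bw j]; rewrite /= -?ball_normE/= distrC.
      exact: bw.
    by have := bw j I; rewrite /= -ball_normE.
  apply: fin_bigcap_measurable => // j _; rewrite -[X in measurable X]setTI.
  apply: mv => //; apply: open_measurable; apply: ball_open; by rewrite invr_gt0.
have -> : S = \bigcup_p (if `[< box p `<=` S >] then box p else set0).
  apply/seteqP; split => [w Sw|w [p _]]; last by case: asboolP => // bS /bS.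
  have [r r0 rS] := locS w Sw.
  have [m mr] : exists m, m.+1%:R^-1 < r / 2.
    have r20 : 0 < (r / 2)^-1 by rewrite invr_gt0 divr_gt0.
    exists (Num.truncn (r / 2)^-1).
    by rewrite invf_plt ?posrE ?divr_gt0// truncnS_gt.
  have [q qP] : exists q : 'rV[rat]_k, forall j, `|v w 0 j - ratr (q 0 j)| < m.+1%:R^-1.
    have /choice[q qP] : forall j, exists q : rat, `|v w 0 j - ratr q| < m.+1%:R^-1.
      move=> j; have : v w 0 j - m.+1%:R^-1 < v w 0 j + m.+1%:R^-1.
        by rewrite ltrD2l (lt_trans (_ : _ < 0))// ?oppr_lt0 invr_gt0.
      move=> /rat_in_itvoo[q]; rewrite in_itv/= => /andP[q1 q2].
      by exists q; rewrite distrC ltr_distl q1.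
    by exists (\row_j q j) => j; rewrite mxE; exact: qP.
  have bS : box (q, m) `<=` S.
    move=> w' bw'; apply: rS; apply: (@le_lt_trans _ _ (m.+1%:R^-1 + m.+1%:R^-1)).
      apply: norm_le_coord; first by rewrite addr_ge0.
      move=> j; rewrite !mxE.
      apply: le_trans (ler_distD (ratr (q 0 j)) _ _) _.
      by apply: lerD; apply: ltW; [exact: qP|rewrite distrC; exact: bw'].
    by rewrite [ltRHS]splitr ltrD.
  exists (q, m) => //; case: asboolP => // _; exact: qP.
apply: countable_bigcupT_measurable; first exact: countableP.
by move=> p; case: ifP.
Qed.

(* [h] is a continuous function of [v] on the range of [v], a set that need not
   be measurable. *)
Lemma measurable_fun_locally v (h : T -> R) : measurable_vec v ->
  (forall w e, 0 < e -> exists2 r, 0 < r & forall w', `|v w - v w'| < r ->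
     `|h w - h w'| < e) ->
  measurable_fun [set: T] h.
Proof.
move=> mv hc _; apply: (measurability _ (RGenOInfty.measurableE R)) => //.
move=> _ [_ [y ->] <-]; rewrite setTI.
apply: (measurable_locally mv) => w; rewrite /= in_itv/= andbT => yw.
have [r r0 rP] := hc w (h w - y) ltac:(by rewrite subr_gt0).
exists r => // w' /rP; rewrite /= in_itv/= andbT ltr_distl => /andP[_].
lra.
Qed.

Lemma measurable_vec_preimage v X : measurable_vec v -> closed X ->
  measurable [set w | X (v w)].
Proof.
move=> mv cX; rewrite -[X in measurable X]setCK; apply: measurableC.
apply: (measurable_locally mv) => w /= nXw.
have /nbhs_ballP[r /= r0 rP] : nbhs (v w) (~` X) by apply: open_nbhs_nbhs; split => //; exact: closed_openC.
by exists r => // w' ww'; apply: rP; rewrite -ball_normE.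
Qed.

Lemma within_continuousP (V : normedModType R) X (G : 'rV[R]_k -> V) x (e : R) :
  {within X, continuous G} -> X x -> 0 < e ->
  exists2 r, 0 < r & forall y, X y -> `|x - y| < r -> `|G x - G y| < e.
Proof.
move=> /subspace_continuousP/(_ x) cG Xx e0.
have /cvgrPdist_lt/(_ e e0) := cG Xx.
rewrite near_withinE => /nbhs_ballP[r /= r0 rP].
by exists r => // y Xy xy; apply: rP => //; rewrite -ball_normE.
Qed.

Lemma differentiable_within_continuous X (f : 'rV[R]_k -> R) :
  (forall x, X x -> differentiable (f : 'rV[R]_k -> R^o) x) ->
  {within X, continuous (f : 'rV[R]_k -> R^o)}.
Proof.
move=> df; apply/subspace_continuousP => x Xx.
by apply: cvg_within_filter; exact: differentiable_continuous (df x Xx).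
Qed.

Lemma measurable_fun_within v X (f : 'rV[R]_k -> R) :
  measurable_vec v -> (forall w, X (v w)) ->
  {within X, continuous (f : 'rV[R]_k -> R^o)} ->
  measurable_fun [set: T] (f \o v).
Proof.
move=> mv Xv cf; apply: (measurable_fun_locally mv) => w e e0.
have [r r0 rP] := within_continuousP cf (Xv w) e0.
by exists r => // w' /rP; apply.
Qed.

Lemma measurable_vec_within v X (G : 'rV[R]_k -> 'rV[R]_k) :
  measurable_vec v -> (forall w, X (v w)) -> {within X, continuous G} ->
  measurable_vec (G \o v).
Proof.
move=> mv Xv cG j; apply: (measurable_fun_locally mv) => w e e0.
have [r r0 rP] := within_continuousP cG (Xv w) e0.
exists r => // w' ww'; apply: le_lt_trans (rP _ (Xv w') ww').
by have := coord_le_norm (G (v w) - G (v w')) j; rewrite !mxE.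
Qed.

Lemma measurable_vec_cst (x : 'rV[R]_k) : measurable_vec (fun=> x).
Proof. by move=> j; exact: measurable_cst. Qed.

Lemma measurable_vecD u v : measurable_vec u -> measurable_vec v ->
  measurable_vec (fun w => u w + v w).
Proof.
move=> mu mv j; under eq_fun do rewrite mxE.
exact: measurable_funD.
Qed.

Lemma measurable_vecZ a v : measurable_vec v -> measurable_vec (fun w => a *: v w).
Proof.
move=> mv j; under eq_fun do rewrite mxE.
by apply: measurable_funM => //; exact: measurable_cst.
Qed.

Lemma measurable_vecB u v : measurable_vec u -> measurable_vec v ->
  measurable_vec (fun w => u w - v w).
Proof.
move=> mu mv j; under eq_fun do rewrite !mxE.
exact: measurable_funB.
Qed.

Lemma measurable_dotp u v : measurable_vec u -> measurable_vec v ->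
  measurable_fun [set: T] (fun w => dotp (u w) (v w)).
Proof.
move=> mu mv; rewrite /dotp; apply: measurable_sum => j.
exact: measurable_funM.
Qed.

Lemma measurable_dual_norm (nrm : 'rV[R]_k -> R) v : is_norm nrm ->
  measurable_vec v -> measurable_fun [set: T] (fun w => dual_norm nrm (v w)).
Proof.
move=> nrmP mv; apply: (measurable_fun_locally mv) => w e e0.
have [K K0 KP] := dual_norm_lipschitz nrmP.
exists (e / K); first by rewrite divr_gt0.
move=> w' ww'; apply: le_lt_trans (KP _ _) _.
by rewrite mulrC -ltr_pdivlMr.
Qed.

End MeasurableVectors.

Lemma measurable_vec_comp {R : realType} {k : nat} d d' (T : measurableType d)
    (T' : measurableType d') (v : T -> 'rV[R]_k) (p : T' -> T) :
  measurable_vec v -> measurable_fun [set: T'] p -> measurable_vec (v \o p).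
Proof. by move=> mv mp j; apply: measurableT_comp (mv j) mp. Qed.

(** Composition with the tuple of coordinates of [v]. The oracle is measurable only over [X], so the
    domain must be a measurable set; closedness of [X] provides this. *)
Lemma measurable_oracle {R : realType} {k : nat} d d' (T : measurableType d)
    (Xi : measurableType d') (X : set 'rV[R]_k)
    (g : Xi -> 'rV[R]_k -> 'rV[R]_k) (z : T -> Xi) (v : T -> 'rV[R]_k) :
  closed X -> jointly_measurable X g ->
  measurable_fun [set: T] z -> measurable_vec v -> (forall w, X (v w)) ->
  measurable_vec (fun w => g (z w) (v w)).
Proof.
move=> cX mg mz mv Xv j; pose vec (s : k.-tuple R) : 'rV[R]_k := \row_(i < k) tnth s i.
have mgj : measurable_fun [set p : Xi * k.-tuple R | X (vec p.2)]
  (fun p : Xi * k.-tuple R => g p.1 (vec p.2) 0 j) := mg j.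
pose G (w : T) : Xi * k.-tuple R := (z w, [tuple v w 0 i | i < k]).
have vecG w : vec (G w).2 = v w.
  by apply/rowP => i; rewrite mxE tnth_mktuple.
have -> : (fun w => g (z w) (v w) 0 j) =
    (fun p : Xi * k.-tuple R => g p.1 (vec p.2) 0 j) \o G.
  by apply/funext => w /=; rewrite vecG.
apply: measurable_comp mgj _; rewrite ?/G.
- apply: measurable_vec_preimage cX => i.
  under eq_fun do rewrite mxE.
  by apply: measurableT_comp (measurable_tnth i) _; exact: measurable_snd.
- by move=> _ [w _ <-] /=; rewrite -/(G w).2 vecG.
- apply: measurable_fun_pair => //; apply/measurable_fun_tnthP => i.
  rewrite (_ : _ \o _ = fun w => v w 0 i)//.
  by apply/funext => w /=; rewrite tnth_mktuple.
Qed.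

(** The two-point inequality implies that [y] factors through [v], so a minimizer given only by its
    defining property can be handled without constructing the argmin map. *)
Lemma measurable_vec_lipschitz {R : realType} {k l : nat} d (T : measurableType d)
    (v : T -> 'rV[R]_k) (y : T -> 'rV[R]_l) (C : R) : 0 < C ->
  measurable_vec v -> (forall w w', `|y w - y w'| <= C * `|v w - v w'|) ->
  measurable_vec y.
Proof.
move=> C0 mv lip j; apply: (measurable_fun_locally mv) => w e e0.
exists (e / C); first by rewrite divr_gt0.
move=> w' ww'; apply: (@le_lt_trans _ _ `|y w - y w'|).
  by have := coord_le_norm (y w - y w') j; rewrite !mxE.
by apply: le_lt_trans (lip _ _) _; rewrite mulrC -ltr_pdivlMr.
Qed.

(** * Independence *)

Section IndependentPair.
Local Open Scope ereal_scope.
Context {R : realType} {d d1 d2 : measure_display}.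
Context {Omega : measurableType d} {T1 : measurableType d1} {T2 : measurableType d2}.
Context (P : probability Omega R) (nu : probability T2 R).
Context (Y : Omega -> T1) (Z : Omega -> T2).
Hypotheses (mY : measurable_fun [set: Omega] Y) (mZ : measurable_fun [set: Omega] Z).
Hypothesis indep : forall A B, measurable A -> measurable B ->
  P (Y @^-1` A `&` Z @^-1` B) = P (Y @^-1` A) * nu B.

Let Ym : {mfun Omega >-> T1} := HB.pack Y (isMeasurableFun.Build _ _ _ _ _ mY).
Let YZ w := (Y w, Z w).
Let mYZ : measurable_fun [set: Omega] YZ.
Proof. exact: measurable_fun_pair. Qed.
Let YZm : {mfun Omega >-> (T1 * T2)%type} :=
  HB.pack YZ (isMeasurableFun.Build _ _ _ _ _ mYZ).
Let PY : probability T1 R := distribution P Ym.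
Let PYZ : probability (T1 * T2)%type R := distribution P YZm.

(** Measurable rectangles determine a product measure, and [indep] gives the joint law on them. *)
Let joint_law (A : set (T1 * T2)) : measurable A -> (PY \x nu) A = PYZ A.
Proof. by move=> mA; apply: product_measure_unique => //= B C mB mC; exact: indep. Qed.

Let integral_joint_law (f : T1 * T2 -> \bar R) :
  \int[PYZ]_p f p = \int[PY \x nu]_p f p.
Proof. by apply: eq_measure_integral => A mA _; exact/esym/joint_law. Qed.

Lemma ge0_integral_independent_le (phi : T1 * T2 -> \bar R) (C : \bar R) :
  measurable_fun setT phi -> (forall p, 0 <= phi p) ->
  (forall y, \int[nu]_z phi (y, z) <= C) ->
  \int[P]_w phi (Y w, Z w) <= C.
Proof.
move=> mphi phi0 phiC.
have -> : \int[P]_w phi (Y w, Z w) = \int[PYZ]_p phi p.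
  by rewrite ge0_integral_pushforward ?preimage_setT.
rewrite integral_joint_law.
rewrite fubini_tonelli1//.
apply: (@le_trans _ _ (\int[PY]_y cst C y)).
  apply: ge0_le_integral => //.
  - by move=> y _; apply: integral_ge0.
  - exact: measurable_fun_fubini_tonelli_F.
  - by move=> y _; exact: phiC.
by rewrite integral_cst// [X in C * X](_ : _ = 1) ?mule1//; exact: probability_setT PY.
Qed.

Lemma integral_independent_eq0 (phi : T1 * T2 -> \bar R) :
  measurable_fun setT phi ->
  P.-integrable setT (fun w => phi (Y w, Z w)) ->
  (forall y, \int[nu]_z phi (y, z) = 0) ->
  \int[P]_w phi (Y w, Z w) = 0.
Proof.
move=> mphi iphi phi0.
have iYZ : PYZ.-integrable setT phi.
  by apply: integrable_pushforward => //; rewrite preimage_setT.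
have -> : \int[P]_w phi (Y w, Z w) = \int[PYZ]_p phi p.
  by rewrite integral_pushforward ?preimage_setT.
have iprod : (PY \x nu).-integrable setT phi.
  apply/integrableP; split => //; case/integrableP: iYZ => _.
  by rewrite integral_joint_law.
rewrite integral_joint_law.
by rewrite -integral12_prod_meas1//; apply: integral0_eq => y _; exact: phi0.
Qed.

End IndependentPair.

Section GeneratedIndependence.
Local Open Scope ereal_scope.
Context {R : realType} {d d2 : measure_display}.
Context {Omega : measurableType d} {T2 : measurableType d2}.
Context (P : probability Omega R) (nu : probability T2 R).
Context (G : set (set Omega)) (Z : Omega -> T2).
Hypotheses (GI : setI_closed G) (mG : G `<=` measurable).
Hypothesis mZ : measurable_fun [set: Omega] Z.

Lemma g_sigma_sub_measurable : <<s G >> `<=` @measurable d Omega.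
Proof. by apply: smallest_sub => //; exact: sigma_algebra_measurable. Qed.

Lemma measurable_fun_g_sigma_id :
  measurable_fun [set: Omega] (idfun : Omega -> g_sigma_algebraType G).
Proof. by move=> _ A mA; rewrite setTI; exact: g_sigma_sub_measurable. Qed.

(** For fixed [B], the sets [A] that satisfy the product formula form a Dynkin system, and [G] is a
    pi-system inside it. The law of [Z] enters for the whole space and for complements. *)
Lemma g_sigma_independent (B : set T2) : measurable B ->
  (forall A, G A -> P (A `&` Z @^-1` B) = P A * nu B) ->
  P (Z @^-1` B) = nu B ->
  forall A, <<s G >> A -> P (A `&` Z @^-1` B) = P A * nu B.
Proof.
move=> mB GB PB.
have mZB : measurable (Z @^-1` B) by rewrite -[X in measurable X]setTI; exact: mZ.
apply: (@dynkin_induction _ (g_sigma_algebraType G) G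
  (fun A => P (A `&` Z @^-1` B) = P A * nu B)) => //.
- by rewrite setTI probability_setT mul1e.
- move=> A /g_sigma_sub_measurable mA AB.
  rewrite probability_setC// muleBl ?fin_num_measure//.
  rewrite mul1e -AB -PB setIC -setDE measureD// 1?setIC//.
  by rewrite -ge0_fin_numE// fin_num_measure.
- move=> F mF tF FB.
  have mF' n : d.-measurable (F n) by apply: g_sigma_sub_measurable; exact: mF.
  rewrite setI_bigcupl measure_bigcup//; last 2 first.
  + by move=> n _; exact: measurableI.
  + exact: trivIset_setIr.
  rewrite measure_bigcup// muleC -(fineK (fin_num_measure nu _ mB)).
  rewrite -nneseriesZl//; apply: eq_eseriesr => n _.
  by rewrite [LHS](FB n) muleC fineK// fin_num_measure.
Qed.

End GeneratedIndependence.

(** * The sigma-algebras generated by the earlier samples *)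

Section IidSamples.
Context {R : realType} {d d' : measure_display}.
Context {Omega : measurableType d} {Xi : measurableType d'}.
Context (P : probability Omega R) (nu : probability Xi R).
Context (xi : nat -> {RV P >-> Xi}).
Hypothesis iid : iid_samples nu xi.

(* A pi-system generating the sigma-algebra of xi 1, ..., xi t.-1. *)
Definition past (t : nat) : set (set Omega) :=
  [set A | exists2 B : nat -> set Xi, (forall j, measurable (B j)) &
    A = \bigcap_(j in [set` index_iota 1 t]) (xi j @^-1` B j)].

Lemma past_setI_closed t : setI_closed (past t).
Proof.
move=> _ _ [B mB ->] [B' mB' ->].
exists (fun j => B j `&` B' j); first by move=> j; exact: measurableI.
by rewrite -bigcapI; apply: eq_bigcapr => j _; rewrite preimage_setI.
Qed.

Lemma measurable_sample t : measurable_fun [set: Omega] (xi t).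
Proof. exact: measurable_funPT. Qed.

Lemma past_measurable t : past t `<=` measurable.
Proof.
move=> _ [B mB ->]; apply: fin_bigcap_measurable => // j _.
by rewrite -[X in measurable X]setTI; exact: measurable_sample.
Qed.

(** On a generator, the product formula compares two instances of mutual independence: the indices
    below [t], and the same list with [t] added, where [C] inserts [B] at index [t]. *)
Lemma past_independent t A B : (1 <= t)%N ->
  <<s past t >> A -> measurable B ->
  (P (A `&` xi t @^-1` B) = P A * nu B)%E.
Proof.
move=> t1 sA mB; have [ind law] := iid.
have lawt s B' : (1 <= s)%N -> measurable B' -> P (xi s @^-1` B') = nu B'.
  by move=> s1 mB'; exact: law.
apply: (g_sigma_independent (@past_setI_closed t) (@past_measurable t)
  (measurable_sample t) mB) => //; last exact: lawt.
move=> _ [B' mB' ->].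
pose C j := if j == t then B else B' j.
have mC j : measurable (C j) by rewrite /C; case: ifP.
have iota1 j : j \in index_iota 1 t -> (1 <= j)%N by rewrite mem_index_iota => /andP[].
have tnotin : t \notin index_iota 1 t by rewrite mem_index_iota ltnn andbF.
have Ceq j : j \in index_iota 1 t -> C j = B' j.
  by rewrite /C; case: eqP => // -> jt; rewrite jt in tnotin.
have h1 := ind (index_iota 1 t) B' (iota_uniq _ _) iota1 mB'.
have h2 := ind (t :: index_iota 1 t) C.
rewrite h1 -(lawt t B t1 mB) -[in RHS](fineK (fin_num_measure P _ _)); last first.
  by rewrite -[X in measurable X]setTI; exact: measurable_sample.
rewrite -EFinM mulrC.
have -> : fine (P (xi t @^-1` B)) * \prod_(j <- index_iota 1 t) fine (P (xi j @^-1` B' j)) =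
    \prod_(j <- t :: index_iota 1 t) fine (P (xi j @^-1` C j)).
  rewrite big_cons /C eqxx; congr (_ * _).
  by rewrite big_seq [RHS]big_seq; apply: eq_bigr => j jt; rewrite -/(C j) Ceq.
rewrite -h2//=.
- congr (P _); apply/seteqP; split => [w [Aw Bw] j /=|w h].
    rewrite inE => /orP[/eqP ->|jt]; first by rewrite /C eqxx.
    by rewrite Ceq//; exact: Aw.
  split => [j /= jt|]; last by have := h t; rewrite /= /C eqxx mem_head; exact.
  by rewrite -Ceq//; apply: h; rewrite /= inE jt orbT.
- by rewrite tnotin iota_uniq.
- by move=> j; rewrite inE => /orP[/eqP ->//|/iota1].
Qed.

Lemma past_le s t : (s <= t)%N -> <<s past s >> `<=` <<s past t >>.
Proof.
move=> st; apply: smallest_sub; first exact: smallest_sigma_algebra.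
move=> _ [B mB ->]; apply: sub_sigma_algebra.
exists (fun j => if (j < s)%N then B j else setT).
  by move=> j; case: ifP.
apply/seteqP; split => w h j /=; rewrite mem_index_iota => /andP[j1 jt].
  by case: ifPn => // js; apply: h; rewrite /= mem_index_iota j1.
by have := h j; rewrite /= mem_index_iota j1 (leq_trans jt st) jt; apply.
Qed.

Lemma sample_past s t : (1 <= s < t)%N ->
  measurable_fun [set: g_sigma_algebraType (past t)]
    (xi s : g_sigma_algebraType (past t) -> Xi).
Proof.
move=> /andP[s1 st] _ B mB; rewrite setTI; apply: sub_sigma_algebra.
(* The preimage under [xi s] is itself a generator: the other samples are left unconstrained. *)
exists (fun j => if j == s then B else setT); first by move=> j; case: ifP.
apply/seteqP; split => [w h j /= _|w h]; first by case: eqP => // ->.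
by have := h s; rewrite /= mem_index_iota s1 st eqxx; apply.
Qed.

Lemma measurable_fun_past d2 (T : measurableType d2) s t (f : Omega -> T) :
  (s <= t)%N ->
  measurable_fun [set: g_sigma_algebraType (past s)] f ->
  measurable_fun [set: g_sigma_algebraType (past t)] f.
Proof.
move=> st mf _ B mB; rewrite setTI.
by have := mf measurableT B mB; rewrite setTI; exact: past_le.
Qed.

Lemma measurable_fun_of_past d2 (T : measurableType d2) t (f : Omega -> T) :
  measurable_fun [set: g_sigma_algebraType (past t)] f ->
  measurable_fun [set: Omega] f.
Proof.
move=> mf _ B mB; rewrite setTI.
have := mf measurableT B mB; rewrite setTI.
exact: (g_sigma_sub_measurable (@past_measurable t)).
Qed.

End IidSamples.

(** * Expectations *)

Section HasExpectation.
Context {R : realType} {d : measure_display} {T : measurableType d}.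
Context (P : probability T R).
Implicit Types (h : T -> R) (m : R).

Lemma has_expectationP h m : has_expectation P h m <->
  P.-integrable [set: T] (EFin \o h) /\ (\int[P]_w (h w)%:E = m%:E)%E.
Proof. by rewrite /has_expectation expectation.unlock. Qed.

Lemma has_expectation_cst m : has_expectation P (cst m) m.
Proof.
apply/has_expectationP; split; first exact: finite_measure_integrable_cst.
by rewrite [LHS](integral_cst P measurableT m%:E)/= probability_setT mule1.
Qed.

Lemma has_expectationD h1 h2 m1 m2 :
  has_expectation P h1 m1 -> has_expectation P h2 m2 ->
  has_expectation P (fun w => h1 w + h2 w) (m1 + m2).
Proof.
move=> /has_expectationP[i1 e1] /has_expectationP[i2 e2]; apply/has_expectationP.
split; first exact: (integrableD measurableT i1 i2).
by rewrite integralD_EFin// e1 e2.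
Qed.

Lemma has_expectationZ a h m :
  has_expectation P h m -> has_expectation P (fun w => a * h w) (a * m).
Proof.
move=> /has_expectationP[i e]; apply/has_expectationP.
split; first exact: (integrableZl measurableT _ i).
by under eq_integral do rewrite EFinM; rewrite integralZl// e EFinM.
Qed.

Lemma has_expectation_sum (I : Type) (s : seq I) (h : I -> T -> R) (m : I -> R) :
  (forall i, has_expectation P (h i) (m i)) ->
  has_expectation P (fun w => \sum_(i <- s) h i w) (\sum_(i <- s) m i).
Proof.
move=> hm; elim: s => [|i s IH].
  rewrite big_nil; under eq_fun do rewrite big_nil.
  exact: has_expectation_cst.
rewrite big_cons; under eq_fun do rewrite big_cons.
exact: has_expectationD.
Qed.

Lemma has_expectation_le h1 h2 m1 m2 :
  has_expectation P h1 m1 -> has_expectation P h2 m2 ->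
  (forall w, h1 w <= h2 w) -> m1 <= m2.
Proof.
move=> /has_expectationP[i1 e1] /has_expectationP[i2 e2] h12.
by rewrite -lee_fin -e1 -e2; apply: le_integral => // w _; rewrite lee_fin.
Qed.

Lemma has_expectation_ge0_le h (C : R) : measurable_fun [set: T] h ->
  (forall w, 0 <= h w) -> (\int[P]_w (h w)%:E <= C%:E)%E ->
  exists2 m, m <= C & has_expectation P h m.
Proof.
move=> mh h0 hC.
have int_ge0 : (0 <= \int[P]_w (h w)%:E)%E.
  by apply: integral_ge0 => w _; rewrite lee_fin.
have fin : (\int[P]_w (h w)%:E)%E \is a fin_num.
  by rewrite ge0_fin_numE// (le_lt_trans hC)// ltry.
exists (fine (\int[P]_w (h w)%:E)%E); first by rewrite -lee_fin fineK.
apply/has_expectationP; split; last by rewrite fineK.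
apply/integrableP; split; first exact/measurable_EFinP.
under eq_integral do rewrite /= ger0_norm//.
by rewrite (le_lt_trans hC)// ltry.
Qed.

Lemma integrable_le_has_expectation h1 h2 m : measurable_fun [set: T] h1 ->
  has_expectation P h2 m -> (forall w, `|h1 w| <= h2 w) ->
  P.-integrable [set: T] (EFin \o h1).
Proof.
move=> mh /has_expectationP[i2 _] h12.
apply: (le_integrable measurableT _ _ i2); first exact/measurable_EFinP.
by move=> w _; rewrite /= lee_fin (le_trans (h12 w))// ler_norm.
Qed.

Lemma expectation_le_has_expectation h1 h2 lo m : measurable_fun [set: T] h1 ->
  has_expectation P h2 m -> (forall w, lo <= h1 w) -> (forall w, h1 w <= h2 w) ->
  ('E_P[h1] <= m%:E)%E.
Proof.
move=> mh h2m lo1 h12.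
have i1 : P.-integrable [set: T] (EFin \o h1).
  (* Since [lo <= h1 <= h2], the function [h2 + 2 * |lo|] dominates the absolute value of [h1]. *)
  apply: (integrable_le_has_expectation mh
    (has_expectationD h2m (has_expectation_cst (2 * `|lo|)))) => w.
  rewrite /cst ler_norml; have := lo1 w; have := h12 w.
  have := ler_norm lo; have := ler_norm (- lo); rewrite normrN.
  move=> *; apply/andP; split; lra.
case/has_expectationP : h2m => i2 <-.
by rewrite unlock; apply: le_integral => // w _; rewrite lee_fin.
Qed.

End HasExpectation.

(** Tonelli's theorem applied to the positive and negative parts of [f]. *)
Lemma measurable_fun_integral {R : realType} d1 d2 (T1 : measurableType d1)
    (T2 : measurableType d2) (m : probability T2 R) (f : T1 * T2 -> \bar R) :
  measurable_fun [set: T1 * T2] f ->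
  measurable_fun [set: T1] (fun x => \int[m]_y f (x, y))%E.
Proof.
move=> mf; under eq_fun do rewrite integralE.
apply: emeasurable_funB.
  under eq_fun do under eq_integral do rewrite funepos_comp/=.
  exact: (measurable_fun_fubini_tonelli_F (f^\+)%E) (measurable_funepos mf) _.
under eq_fun do under eq_integral do rewrite funeneg_comp/=.
exact: (measurable_fun_fubini_tonelli_F (f^\-)%E) (measurable_funeneg mf) _.
Qed.

(** * The expected rate *)

Section AcceleratedMirrorDescent.
Context {R : realType} (n a b c : R).
Hypotheses (hn : 0 < n) (ha : 0 < a) (hb : 0 < b) (hc : 0 < c).
Context (k : nat) (X : set 'rV[R]_k) (nrm : 'rV[R]_k -> R).
Context (dXi : measure_display) (Xi : measurableType dXi) (nu : probability Xi R).
Context (f : Xi -> 'rV[R]_k -> R) (g : Xi -> 'rV[R]_k -> 'rV[R]_k).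
Context (F H : 'rV[R]_k -> R) (xF : 'rV[R]_k) (D L sigma mu : R) (T : nat).
Context (dO : measure_display) (Omega : measurableType dO).
Context (P : probability Omega R) (xi : nat -> {RV P >-> Xi}).
Context (x1 xag1 : 'rV[R]_k) (x xmd xag : nat -> Omega -> 'rV[R]_k).
Hypotheses (closedX : closed X) (convexX : convex_set X) (nrmP : is_norm nrm).
Hypotheses (objF : stochastic_objective nu X f g F) (xFmin : is_argmin X F xF).
Hypotheses (C1H : C1_on X H) (Hsc : strongly_convex1 X nrm H).
Hypotheses (L0 : 0 < L) (mu0 : 0 < mu).
Hypothesis smF : forall y z, X y -> X z -> bregman F y z <= L / 2 * nrm (y - z) ^+ 2.
Hypothesis varF : forall y, X y ->
  ('E_nu[fun z => (dual_norm nrm (g z y - gradient F y) ^+ 2)%R]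
     <= (sigma ^+ 2)%:E)%E.
Hypothesis diamX : forall y z, X y -> X z -> nrm (y - z) ^+ 2 <= D ^+ 2.
Hypothesis HD : forall y, X y -> H xF - H y <= D ^+ 2.

Let al := alpha_step a n.
Let be := beta_step b n mu.
Let ga := gamma_step c n mu.
Let A := cumul al.

Hypothesis adm : admissible_steps al be ga.
Hypotheses (T1 : (1 <= T)%N) (iid : iid_samples nu xi) (Xx1 : X x1) (Xxag1 : X xag1).
Hypothesis run : forall w, acmd_run X g H al be ga T x1 xag1
  (fun t => xi t w) (x ^~ w) (xmd ^~ w) (xag ^~ w).

Lemma oracle_dotp y v : X y ->
  has_expectation nu (fun z => dotp (g z y) v) (dotp (gradient F y) v).
Proof.
move=> Xy; rewrite /dotp.
apply: (@has_expectation_sum _ _ _ nu _ _ (fun i z => g z y 0 i * v 0 i)) => i.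
under eq_fun do rewrite mulrC; rewrite mulrC.
apply: has_expectationZ; exact: so_oracle_unbiased objF _ _ Xy.
Qed.

(** The subgradient inequality of the oracle holds for each sample; taking expectations replaces [f]
    and [g] by [F] and its gradient. *)
Lemma objective_subgradient y z : X y -> X z ->
  F y + dotp (gradient F y) (z - y) <= F z.
Proof.
move=> Xy Xz.
apply: (has_expectation_le
  (has_expectationD (so_expectation objF Xy) (oracle_dotp (z - y) Xy))
  (so_expectation objF Xz)).
by move=> s; exact: so_oracle objF _ _ _ Xy Xz.
Qed.

Let noise t w : 'rV[R]_k := g (xi t w) (xmd t w) - gradient F (xmd t w).

Lemma acmd_iterate t w : (1 <= t <= T)%N -> X (x t w) -> X (xag t w) ->
  [/\ X (xmd t w), X (x t.+1 w), X (xag t.+1 w) &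
  A t * (F (xag t.+1 w) - F xF) + (ga t + be t) * bregman H xF (x t.+1 w) <=
  A t.-1 * (F (xag t w) - F xF) + ga t * bregman H xF (x t w) + be t * D ^+ 2
  - al t * dotp (noise t w) (x t w - xF)
  + al t ^+ 2 / ga t * dual_norm nrm (noise t w) ^+ 2
  + Num.max 0 (L * al t ^+ 2 / (2 * A t) - ga t / 4) * D ^+ 2].
Proof.
move=> tT Xx Xag; have /andP[t1 _] := tT.
have [_ _ /(_ t tT)[mdE xE agE]] := run w.
have AtE : A t = A t.-1 + al t by rewrite -[in LHS](prednK t1) /A cumulS prednK.
rewrite -/A AtE in mdE agE *.
have := @acmd_step _ _ X nrm F H convexX nrmP C1H.1 Hsc L D (al t) (be t) (ga t)
  (A t.-1) (g (xi t w) (xmd t w)) (x t w) (xag t w) (x t.+1 w) xF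
  objective_subgradient smF diamX HD (alpha_step_gt0 n ha t1)
  (beta_step_ge0 n hb mu0 t) (gamma_step_gt0 hn hc mu0 t1)
  (cumul_alpha_step_ge0 n ha t.-1) Xx Xag xFmin.1.
rewrite /= -mdE -agE => /(_ xE)[Xmd Xag' ineq].
by split => //; exact: xE.1.
Qed.

Lemma acmd_iterates_in t w : (1 <= t <= T.+1)%N -> X (x t w) /\ X (xag t w).
Proof.
elim: t => // -[_ _|t IH tT]; first by have [-> -> _] := run w.
have tT' : (1 <= t.+1 <= T)%N by [].
have [Xx Xag] := IH (leqW tT').
by have [] := acmd_iterate tT' Xx Xag.
Qed.

Lemma acmd_xmd_in t w : (1 <= t <= T)%N -> X (xmd t w).
Proof.
move=> tT; have /andP[t1 tT'] := tT.
have [Xx Xag] : X (x t w) /\ X (xag t w).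
  by apply: acmd_iterates_in; rewrite t1 leqW.
by have [] := acmd_iterate tT Xx Xag.
Qed.

(** One iteration leaves the weight [ga t + be t] on the new divergence, which dominates [ga t.+1]
    by the first admissibility inequality. *)
Lemma acmd_telescope t w : (t <= T)%N ->
  A t * (F (xag t.+1 w) - F xF) + ga t.+1 * bregman H xF (x t.+1 w) <=
  ga 1%N * bregman H xF x1 + \sum_(1 <= s < t.+1)
    (be s * D ^+ 2 - al s * dotp (noise s w) (x s w - xF)
     + al s ^+ 2 / ga s * dual_norm nrm (noise s w) ^+ 2
     + Num.max 0 (L * al s ^+ 2 / (2 * A s) - ga s / 4) * D ^+ 2).
Proof.
elim: t => [_|t IH tT].
  (* [A 0 = 0] removes the arbitrary starting point [xag1]. *)
  rewrite big_geq// /A /cumul big_geq// mul0r add0r addr0.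
  by have [-> _ _] := run w.
have [Xx Xag] : X (x t.+1 w) /\ X (xag t.+1 w).
  by apply: acmd_iterates_in; exact: leqW tT.
have [_ Xx' _ ineq] := acmd_iterate (t := t.+1) tT Xx Xag.
have B0 : 0 <= bregman H xF (x t.+2 w).
  by apply: le_trans (Hsc xFmin.1 Xx'); rewrite divr_ge0// sqr_ge0.
have gb : ga t.+2 * bregman H xF (x t.+2 w) <=
    (ga t.+1 + be t.+1) * bregman H xF (x t.+2 w).
  by apply: ler_wpM2r => //; have [h _] := adm (isT : (1 <= t.+1)%N); rewrite -lerBlDl.
have {}IH := IH (ltnW tT).
rewrite big_nat_recr//=.
move: IH ineq gb; rewrite [t.+1.-1]/=.
move: (A _ * _) (A _ * _) (ga _ * _) (ga _ * _) ((_ + _) * _) (ga _ * _) => *.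
lra.
Qed.

(** [Omega] with the sigma-algebra of the samples [xi 1, ..., xi t.-1]. Measurability on [Pt t] says
    that a quantity is determined before sample [t] is drawn. *)
Let Pt t := g_sigma_algebraType (past xi t).

(* The gradient of [F] is not assumed continuous, but it is the expectation of
   the jointly measurable oracle. *)
Lemma measurable_gradient d (S : measurableType d) (v : S -> 'rV[R]_k) :
  measurable_vec v -> (forall s, X (v s)) ->
  measurable_vec (fun s => gradient F (v s)).
Proof.
move=> mv Xv j.
have mg : measurable_fun [set: S * Xi] (fun p => (g p.2 (v p.1) 0 j)%:E).
  apply/measurable_EFinP.
  apply: (measurable_oracle closedX (so_oracle_measurable objF)
    (v := v \o fst) (z := snd)) => [//||p]; last exact: Xv.
  by apply: measurable_vec_comp mv _; exact: measurable_fst.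
have := measurable_fun_integral nu mg.
rewrite (_ : (fun s => _) = EFin \o (fun s => gradient F (v s) 0 j)).
  by move/measurable_EFinP.
apply/funext => s /=.
by have /has_expectationP[_ ->] := so_oracle_unbiased objF j (Xv s).
Qed.

(* The argmin is a Lipschitz function of the linear term of its objective. *)
Lemma measurable_prox_step d (S : measurableType d) t (gs q p : S -> 'rV[R]_k) :
  (1 <= t)%N ->
  measurable_vec gs -> measurable_vec q -> (forall s, X (q s)) ->
  (forall s, is_argmin X (fun y => al t * dotp (gs s) y + be t * H y
                   + ga t * bregman H y (q s)) (p s)) ->
  measurable_vec p.
Proof.
move=> t1 mgs mq Xq pmin.
have [K K0 KP] := norm_le_is_norm nrmP.
have [K' K'0 K'P] := dual_norm_le_norm nrmP.
have bg0 : 0 < be t + ga t.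
  by rewrite ltr_wpDl ?(beta_step_ge0 n hb mu0 t) ?(gamma_step_gt0 hn hc mu0 t1).
have mv : measurable_vec (fun s => al t *: gs s - ga t *: gradient H (q s)).
  apply: measurable_vecB; first exact: measurable_vecZ.
  apply: measurable_vecZ; exact: (measurable_vec_within mq Xq C1H.2).
apply: (@measurable_vec_lipschitz _ _ _ _ _ _ _ (K * (K' / (be t + ga t))) _ mv).
  by rewrite mulr_gt0// divr_gt0.
move=> s s'; apply: le_trans (KP _) _; rewrite -mulrA ler_pM2l//.
rewrite mulrAC ler_pdivlMr// mulrC.
apply: le_trans (prox_lipschitz convexX nrmP C1H.1 Hsc (pmin s) (pmin s') bg0) _.
exact: K'P.
Qed.

(** The index shift matters: [x t.+1] uses [xi t], which enters the sigma-algebra exactly at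
    [Pt t.+1]. Hence [x t] is measurable for a past independent of [xi t]. *)
Lemma acmd_measurable t : (1 <= t <= T.+1)%N ->
  measurable_vec (x t : Pt t -> 'rV[R]_k) /\
  measurable_vec (xag t : Pt t -> 'rV[R]_k).
Proof.
elim: t => // -[_ _|t IH tT].
  have -> : x 1%N = fun=> x1 by apply/funext => w; have [-> _ _] := run w.
  have -> : xag 1%N = fun=> xag1 by apply/funext => w; have [_ -> _] := run w.
  by split; exact: measurable_vec_cst.
have tT' : (1 <= t.+1 <= T)%N by [].
have [mx0 mag0] := IH (leqW tT').
have lift (v : Omega -> 'rV[R]_k) : measurable_vec (v : Pt t.+1 -> 'rV[R]_k) ->
    measurable_vec (v : Pt t.+2 -> 'rV[R]_k).
  by move=> mv j; exact: measurable_fun_past (leqnSn _) (mv j).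
have mx := lift _ mx0; have mag := lift _ mag0.
have Xin w := @acmd_iterates_in t.+1 w (leqW tT').
have mdE : xmd t.+1 = fun w => (A t / A t.+1) *: xag t.+1 w + (al t.+1 / A t.+1) *: x t.+1 w.
  by apply/funext => w; have [_ _ /(_ _ tT')[]] := run w.
have mmd : measurable_vec (xmd t.+1 : Pt t.+2 -> 'rV[R]_k).
  by rewrite mdE; apply: measurable_vecD; exact: measurable_vecZ.
have mg : measurable_vec ((fun w => g (xi t.+1 w) (xmd t.+1 w)) : Pt t.+2 -> 'rV[R]_k).
  apply: (measurable_oracle closedX (so_oracle_measurable objF)) mmd _.
    by apply: sample_past; rewrite ltnSn.
  by move=> w; exact: acmd_xmd_in.
have mx' : measurable_vec (x t.+2 : Pt t.+2 -> 'rV[R]_k).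
  apply: (@measurable_prox_step _ (Pt t.+2) t.+1 _ _ _ isT mg mx).
    by move=> w; have [] := Xin w.
  by move=> w; have [_ _ /(_ _ tT')[]] := run w.
split => //.
have -> : xag t.+2 = fun w => (A t / A t.+1) *: xag t.+1 w + (al t.+1 / A t.+1) *: x t.+2 w.
  by apply/funext => w; have [_ _ /(_ _ tT')[]] := run w.
by apply: measurable_vecD; exact: measurable_vecZ.
Qed.

Lemma acmd_measurable_md t : (1 <= t <= T)%N ->
  measurable_vec (xmd t : Pt t -> 'rV[R]_k).
Proof.
move=> tT; have /andP[t1 tT'] := tT.
have [mx mag] : measurable_vec (x t : Pt t -> 'rV[R]_k) /\
  measurable_vec (xag t : Pt t -> 'rV[R]_k) by apply: acmd_measurable; rewrite t1 leqW.
have -> : xmd t = fun w => (A t.-1 / A t) *: xag t w + (al t / A t) *: x t w.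
  by apply/funext => w; have [_ _ /(_ _ tT)[]] := run w.
by apply: measurable_vecD; exact: measurable_vecZ.
Qed.

(** * Moments of the noise of one iteration *)

Section Noise.
Variables (t : nat) (tT : (1 <= t <= T)%N).

Let t1 : (1 <= t)%N. Proof. by case/andP: tT. Qed.

Let S : measurableType _ := Pt t.

(** The noise with its two sources of randomness separated: the first argument fixes the past, hence
    [xmd t], and the second is the fresh sample. [noise t w] is its value at [(w, xi t w)]. *)
Let noise2 (p : S * Xi) : 'rV[R]_k := g p.2 (xmd t p.1) - gradient F (xmd t p.1).

Let Xmd w : X (xmd t w). Proof. exact: acmd_xmd_in. Qed.

Let Xx w : X (x t w).
Proof.
by have [] := @acmd_iterates_in t w; rewrite // t1; case/andP: tT => _ /leqW.
Qed.

Let mnoise2 : measurable_vec noise2.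
Proof.
have mmd : measurable_vec (xmd t \o fst : S * Xi -> 'rV[R]_k).
  by apply: measurable_vec_comp (acmd_measurable_md tT) _; exact: measurable_fst.
apply: measurable_vecB.
  apply: (measurable_oracle closedX (so_oracle_measurable objF)
    (v := xmd t \o fst : S * Xi -> 'rV[R]_k) (z := snd)) => //.
  by move=> p; exact: Xmd.
by apply: (measurable_gradient mmd) => p; exact: Xmd.
Qed.

Let midS : measurable_fun [set: Omega] (idfun : Omega -> S).
Proof. exact: measurable_fun_g_sigma_id (@past_measurable _ _ _ _ _ _ xi t). Qed.

Let mpair : measurable_fun [set: Omega] (fun w => (w : S, xi t w)).
Proof. exact: measurable_fun_pair midS (measurable_sample xi t). Qed.

Let indep (B : set S) (C : set Xi) : measurable B -> measurable C ->
  (P ((idfun : Omega -> S) @^-1` B `&` xi t @^-1` C) =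
   P ((idfun : Omega -> S) @^-1` B) * nu C)%E.
Proof. by move=> mB mC; exact: past_independent. Qed.

Lemma noise_dual_norm_expectation : exists2 m, m <= sigma ^+ 2 &
  has_expectation P (fun w => dual_norm nrm (noise t w) ^+ 2) m.
Proof.
have mphi : measurable_fun [set: S * Xi] (fun p => dual_norm nrm (noise2 p) ^+ 2).
  by apply: measurable_funX; exact: measurable_dual_norm.
apply: has_expectation_ge0_le.
- exact: measurableT_comp mphi mpair.
- by move=> w; exact: sqr_ge0.
- apply: (ge0_integral_independent_le midS (measurable_sample xi t) indep
    (phi := fun p => (dual_norm nrm (noise2 p) ^+ 2)%:E)).
  + exact/measurable_EFinP.
  + by move=> p; rewrite lee_fin sqr_ge0.
  + by move=> w; have := varF (Xmd w); rewrite expectation.unlock.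
Qed.

Lemma noise_dotp_expectation :
  has_expectation P (fun w => dotp (noise t w) (x t w - xF)) 0.
Proof.
have mx : measurable_vec ((fun p => x t p.1 - xF) : S * Xi -> 'rV[R]_k).
  apply: measurable_vecB (measurable_vec_cst _).
  apply: (measurable_vec_comp (T := S) (v := x t)); last exact: measurable_fst.
  by have [] := @acmd_measurable t; rewrite // t1; case/andP: tT => _ /leqW.
have mphi : measurable_fun [set: S * Xi] (fun p => dotp (noise2 p) (x t p.1 - xF)).
  exact: measurable_dotp.
have [m _ hm] := noise_dual_norm_expectation.
have iphi : P.-integrable [set: Omega] (EFin \o (fun w => dotp (noise t w) (x t w - xF))).
  (* The pairing is at most a product [p * q] of a dual norm and a norm, hence at most
     [p ^+ 2 + D ^+ 2], which is integrable by the second moment bound. *)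
  apply: (integrable_le_has_expectation (measurableT_comp mphi mpair)
    (has_expectationD hm (has_expectation_cst P (D ^+ 2)))) => w /=.
  apply: le_trans (norm_dotp_le_dual nrmP _ _) _; rewrite /cst.
  have := diamX (Xx w) xFmin.1; rewrite -/(noise t w).
  move: (dual_norm _ _) (nrm _) => p q qD.
  have := sqr_ge0 (p - q); have := sqr_ge0 p; have := sqr_ge0 q.
  rewrite sqrrB; move=> *; lra.
apply/has_expectationP; split => //.
apply: (integral_independent_eq0 midS (measurable_sample xi t) indep
  (phi := fun p => (dotp (noise2 p) (x t p.1 - xF))%:E)) => //.
  exact/measurable_EFinP.
(* With the past frozen at [w], the point [xmd t w] is constant and unbiasedness of the oracle
   applies. *)
move=> w; rewrite /noise2/=.
have h1 := oracle_dotp (x t w - xF) (Xmd w).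
have /has_expectationP[_] := has_expectationD h1
  (has_expectation_cst nu (- dotp (gradient F (xmd t w)) (x t w - xF))).
rewrite subrr => /(etrans _); apply; apply: eq_integral => z _; congr EFin.
exact: dotpBl.
Qed.

End Noise.

Lemma acmd_rate :
  ('E_P[fun w => F (xag T.+1 w)] - (F xF)%:E <=
   (rate_const n a b c * (mu * bregman H xF x1 / (n * T%:R `^ (n + 1))
         + mu * D ^+ 2
         + n * sigma ^+ 2 / (mu * T%:R)
         + L * D ^+ 2 / T%:R * (L * n / (mu * T%:R ^+ 2)) `^ (n / 2)))%:E)%E.
Proof.
(* [m t] is the second moment of the noise at iteration [t]; an index outside the run gets the
   default witness 0. *)
have /choice[m mP] : forall t, exists m, (1 <= t <= T)%N -> m <= sigma ^+ 2 /\
    has_expectation P (fun w => dual_norm nrm (noise t w) ^+ 2) m.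
  move=> t; have [tT|_] := boolP (1 <= t <= T)%N; last by exists 0.
  by have [m m1 m2] := noise_dual_norm_expectation tT; exists m.
have AT0 : 0 < A T by exact: cumul_alpha_step_gt0.
pose step s w := be s * D ^+ 2 - al s * dotp (noise s w) (x s w - xF)
     + al s ^+ 2 / ga s * dual_norm nrm (noise s w) ^+ 2
     + Num.max 0 (L * al s ^+ 2 / (2 * A s) - ga s / 4) * D ^+ 2.
pose mstep s := be s * D ^+ 2 + al s ^+ 2 / ga s * m s
     + Num.max 0 (L * al s ^+ 2 / (2 * A s) - ga s / 4) * D ^+ 2.
have step_exp s : (1 <= s <= T)%N -> has_expectation P (step s) (mstep s).
  move=> sT; have [_ ms] := mP s sT.
  have := has_expectationD (has_expectationD (has_expectationD
    (has_expectation_cst P (be s * D ^+ 2))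
    (has_expectationZ (- al s) (noise_dotp_expectation sT)))
    (has_expectationZ (al s ^+ 2 / ga s) ms))
    (has_expectation_cst P (Num.max 0 (L * al s ^+ 2 / (2 * A s) - ga s / 4) * D ^+ 2)).
  rewrite mulr0 addr0 /step; under eq_fun do rewrite mulNr.
  exact.
(* [W] is the pathwise upper bound on [F (xag T.+1 w)] obtained from the telescoped inequality by
   dropping the last divergence and dividing by [A T]; [mW] is its expectation. *)
pose W w := F xF + (A T)^-1 * (ga 1%N * bregman H xF x1 + \sum_(1 <= s < T.+1) step s w).
pose mW := F xF + (A T)^-1 * (ga 1%N * bregman H xF x1 + \sum_(1 <= s < T.+1) mstep s).
have W_exp : has_expectation P W mW.
  apply: has_expectationD; first exact: has_expectation_cst.
  apply: has_expectationZ; apply: has_expectationD; first exact: has_expectation_cst.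
  (* Steps outside [1, ..., T] are replaced by 0, since [has_expectation_sum] asks for an
     expectation at every index. *)
  under eq_fun do rewrite big_nat big_mkcond; rewrite big_nat big_mkcond.
  apply: has_expectation_sum => s; case: ifPn => // sT.
    exact: step_exp.
  exact: has_expectation_cst.
have XT w : X (x T.+1 w) /\ X (xag T.+1 w) by apply: acmd_iterates_in; rewrite leqnn.
have FW w : F (xag T.+1 w) <= W w.
  rewrite /W -lerBlDl ler_pdivlMl//.
  have := acmd_telescope w (leqnn T); rewrite -/(step _ w).
  have gB0 : 0 <= ga T.+1 * bregman H xF (x T.+1 w).
    apply: mulr_ge0; first by rewrite ltW// gamma_step_gt0.
    have [] := XT w.
    by move=> /(Hsc xFmin.1) + _; apply: le_trans; rewrite divr_ge0// sqr_ge0.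
  by apply: le_trans; rewrite lerDl.
have mF : measurable_fun [set: Omega] (fun w => F (xag T.+1 w)).
  have [_ mag] := @acmd_measurable T.+1 (leqnn _).
  apply: (measurable_fun_within (v := xag T.+1) (X := X)).
  - by move=> j; exact: measurable_fun_of_past (mag j).
  - by move=> w; have [] := XT w.
  - exact/differentiable_within_continuous/(so_differentiable objF).
(* Together with the upper bound [W], this makes [F (xag T.+1 w)] integrable. *)
have lo w : F xF <= F (xag T.+1 w) by apply: xFmin.2; have [] := XT w.
have EF := expectation_le_has_expectation mF W_exp lo FW.
apply: le_trans (leeB EF (lexx _)) _; rewrite -EFinB lee_fin /mW addrAC subrr add0r.
rewrite ler_pdivrMl//.
have B0 : 0 <= bregman H xF x1.
  by apply: le_trans (Hsc xFmin.1 Xx1); rewrite divr_ge0// sqr_ge0.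
apply: le_trans (step_sums_le_rate hn ha hb hc mu0 adm D sigma B0 L0 T1).
rewrite -!addrA lerD2l !mulr_sumr -!big_split/=.
rewrite [leLHS]big_nat [leRHS]big_nat; apply: ler_sum => s /andP[s1 sT].
have [ms _] := mP s (introT andP (conj s1 sT)).
rewrite /mstep -!addrA mulrC lerD2l [_ * D ^+ 2]mulrC lerD2r mulrC.
by rewrite ler_wpM2r// divr_ge0 ?sqr_ge0// ltW// gamma_step_gt0.
Qed.

End AcceleratedMirrorDescent.

Theorem theorem3p2 (R : realType) (n a b c : R)
    (hn : 0 < n) (ha : 0 < a) (hb : 0 < b) (hc : 0 < c) :
  exists C : R, 0 < C /\
  forall (k : nat) (X : set 'rV[R]_k) (nrm : 'rV[R]_k -> R)
    (dXi : measure_display) (Xi : measurableType dXi) (nu : probability Xi R)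
    (f : Xi -> 'rV[R]_k -> R) (g : Xi -> 'rV[R]_k -> 'rV[R]_k)
    (F H : 'rV[R]_k -> R) (xF : 'rV[R]_k) (D L sigma mu : R) (T : nat)
    (dO : measure_display) (Omega : measurableType dO)
    (P : probability Omega R) (xi : nat -> {RV P >-> Xi})
    (x1 xag1 : 'rV[R]_k) (x xmd xag : nat -> Omega -> 'rV[R]_k),
  closed X -> convex_set X -> is_norm nrm ->
  stochastic_objective nu X f g F ->
  is_argmin X F xF ->
  C1_on X H -> strictly_convex_function X H -> strongly_convex1 X nrm H ->
  0 < D -> 0 < L -> 0 < sigma ->
  (forall y z, X y -> X z -> bregman F y z <= L / 2 * nrm (y - z) ^+ 2) ->
  (forall y, X y ->
     ('E_nu[fun z => (dual_norm nrm (g z y - gradient F y) ^+ 2)%R]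
        <= (sigma ^+ 2)%:E)%E) ->
  (forall y z, X y -> X z -> nrm (y - z) ^+ 2 <= D ^+ 2) ->
  (forall y, X y -> H xF - H y <= D ^+ 2) ->
  0 < mu ->
  admissible_steps (alpha_step a n) (beta_step b n mu) (gamma_step c n mu) ->
  (1 <= T)%N -> 2 * Num.sqrt (L / mu) <= T%:R ->
  iid_samples nu xi ->
  X x1 -> X xag1 ->
  (forall w, acmd_run X g H
     (alpha_step a n) (beta_step b n mu) (gamma_step c n mu) T x1 xag1
     (fun t => xi t w) (x ^~ w) (xmd ^~ w) (xag ^~ w)) ->
  ('E_P[fun w => F (xag T.+1 w)] - (F xF)%:E <=
   (C * (mu * bregman H xF x1 / (n * T%:R `^ (n + 1))
         + mu * D ^+ 2
         + n * sigma ^+ 2 / (mu * T%:R)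
         + L * D ^+ 2 / T%:R * (L * n / (mu * T%:R ^+ 2)) `^ (n / 2)))%:E)%E.
Proof.
exists (rate_const n a b c); split; first exact: rate_const_gt0.
move=> k X nrm dXi Xi nu f g F H xF D L sigma mu T dO Omega P xi x1 xag1 x xmd xag.
move=> closedX convexX nrmP objF xFmin C1H _ Hsc _ L0 _ smF varF diamX HD mu0 adm.
move=> T1 _ iid Xx1 Xxag1 run.
exact: (acmd_rate hn ha hb hc closedX convexX nrmP objF xFmin C1H Hsc L0 mu0
  smF varF diamX HD adm T1 iid Xx1 Xxag1 run).
Qed.
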